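(* Let $\mu\in\mathbb R$, let $\psi:\mathbb Z^2\to\mathbb C$ be a discrete holomorphic function with edge-labelling $(m_{ij})$, and let $m\in\mathbb R\setminus\{0\}$ with $m_{ij}+m\neq0$ for all edges. Let $\Psi=\begin{pmatrix}a&b\\c&d\end{pmatrix}:\mathbb Z^2\to SL(2,\mathbb C)$ be a solution of $$\Psi_j=\Psi_iB_{ij},\qquad B_{ij}=\frac{1}{(\psi_i-\psi_j)\sqrt{m_{ij}}\sqrt{m_{ij}+m}}\begin{pmatrix} m_{ij}(\psi_i-\psi_j)+m\psi_i & -m\psi_i\psi_j\\ m & m_{ij}(\psi_i-\psi_j)-m\psi_j\end{pmatrix}$$ on all edges. Let $x:\mathbb Z^2\to\mathbb R^{3,1}$ be the discrete surface with Hermitian representative $$X=\Psi\begin{pmatrix}1&0\\0&-\mu\end{pmatrix}\Psi^\ast,\qquad\text{and let}\qquad G=\Big\langle\begin{pmatrix}|\phi|^2&\phi\\ \overline\phi&1\end{pmatrix}\Big\rangle,\quad \phi=\frac{a\psi+b}{c\psi+d}$$ (with $G=\big\langle\begin{pmatrix}1&0\\0&0\end{pmatrix}\big\rangle$ where $\phi=\infty$). Assume $x_i\not\perp G_i$ at all vertices. Then: (1) $x$ has constant discrete mean curvature $H=\frac1{\sqrt{|\mu|}}$ in the quadric $Q_\mu=\{v:(v,v)=\mu\}$ if $\mu\neq0$, and is intrinsically flat in the light cone $\mathcal L$ if $\mu=0$ (with respect to the lightlike Gauss map $G$). (2) Every discrete cmc $\frac1{\sqrt{|\mu|}}$ surface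 in $Q_\mu$ ($\mu\ne0$), respectively every discrete intrinsically flat surface in $\mathcal L$ ($\mu=0$), can locally be constructed in this way. (3) These Weierstrass-type representations can be viewed as certain applications of the $\Omega$-dual transformation to the prescribed discrete lightlike Gauss map $G$: the Legendre immersion $L=x+G$ is $\Omega$-dual to $G$.
   Context: **Minkowski space.** $\mathbb R^{3,1}$ is the real vector space with basis $e_0,e_1,e_2,e_3$ and product $(e_0,e_0)=-1$, $(e_n,e_n)=1$ ($n=1,2,3$), $(e_n,e_{n'})=0$ for $n\ne n'$. $\mathcal L=\{v:(v,v)=0\}$; $\mathbb P\mathcal L$ is the set of one-dimensional null subspaces; $\langle\cdot\rangle$ denotes linear span. In the Hermitian model $\mathbb R^{3,1}$ is the space of Hermitian $2\times2$ matrices with $(v,v)=-\det v$, where $e_0=\begin{pmatrix}1&0\\0&1\end{pmatrix}$, $e_1=\begin{pmatrix}0&1\\1&0\end{pmatrix}$, $e_2=\begin{pmatrix}0&\mathrm i\\-\mathrm i&0\end{pmatrix}$, $e_3=\begin{pmatrix}1&0\\0&-1\end{pmatrix}$; $B^\ast=\overline B^T$. **Discrete holomorphic.** $(ijkl)$ denotes an elementary quadrilateral (face) of $\mathbb Z^2$ with vertices in cyclic order. $\psi:\mathbb Z^2\to\mathbb C$ is discrete holomorphic if there is a real nowhere zero edge function $m_{ij}=m_{ji}$, equal on opposite edges of each face ($m_{ij}=m_{lk}$, $m_{il}=m_{jk}$), with $\frac{\psi_i-\psi_j}{\psi_j-\psi_k}\frac{\psi_k-\psi_l}{\psi_l-\psi_i}=\frac{m_{il}}{m_{ij}}<0$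 on each face. The matrices $B_{ij}$ are determined up to sign; the (possibly imaginary) square roots are chosen independently of the direction of an edge and equal on opposite edges of a face. **Discrete surfaces.** A discrete surface is a map $x:\mathbb Z^2\to\mathbb R^{3,1}$; $dx_{ij}=x_i-x_j$ on edges, $\delta x_{ik}=x_i-x_k$ on diagonals. It is planar if each face is mapped to coplanar points, and circular if it is planar and for each face there is $c\in\mathbb R^{3,1}$ with $(x-c,x-c)$ equal at its four vertices. Two discrete surfaces $x,y$ are edge-parallel if $dx_{ij},dy_{ij}$ are parallel on every edge; for these the mixed area is $A(x,y)_{ijkl}=\frac14(\delta x_{ik}\wedge\delta y_{jl}-\delta x_{jl}\wedge\delta y_{ik})\in\Lambda^2\mathbb R^{3,1}$. Standing assumption: discrete surfaces for which curvatures are considered satisfy $A(x,x)\neq0$ on every face. A discrete Legendre immersion is a map $L$ from $\mathbb Z^2$ to the affine null lines of $\mathbb R^{3,1}$ with $L_i\cap L_j\ne\emptyset$ for every edge; it has the form $L=x+G$ with $x_i\in L_i$ and lightlike Gauss map $G:\mathbb Z^2\to\mathbb P\mathcal L$. $\Gamma L$, $\Gamma G$ denote sections (maps $y$ with $y_i\in L_i$, resp. nowhere zero $g$ with $\langle g_i\rangle=G_i$). Also assumed: on each face the four lines of $G$ span a space of dimension at least $3$. **Curvatures.** Let $x$ be a circular discrete surface and $L=x+G$ a discrete Legendre immersion with $x_i\not\perp G_i$. If $(x,x)=\mu\ne0$: let $g\in\Gamma G$ with $(g,x)=\mu$ and $n=(g-x)/\sqrt{|\mu|}$, so $(n,x)=0$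 and $G=\langle x+\sqrt{|\mu|}\,n\rangle$; $n$ is edge-parallel to $x$, $G$ is called the hyperbolic Gauss map of $x$, and the discrete mean curvature $H$ is defined on faces by $A(x,n)+H A(x,x)=0$; $x$ is cmc $\frac1{\sqrt{|\mu|}}$ if $H\equiv\frac1{\sqrt{|\mu|}}$. If $(x,x)=0$: $x$ is intrinsically flat if $A(x,g)=0$ on all faces for some $g\in\Gamma G$ edge-parallel to $x$ (i.e. the light cone mean curvature $H_g$, defined by $A(x,g)+H_gA(x,x)=0$, vanishes). **$\Omega$-duality.** Two discrete surfaces are Christoffel dual if they are edge-parallel, circular, and have vanishing mixed area. A Legendre immersion $L$ with lightlike Gauss map $G$ is $\Omega$-dual to $G$ (equivalently: $L$ is discrete L-isothermic) if there are $y\in\Gamma L$ and $g\in\Gamma G$ which are Christoffel dual.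
   Formalization: X carries vertex signs (jumping where m_ij(m_ij+m)<0; all 1 if no such edge). In (2), for g_j spanning G_j, (x_i,g_j)≠0 and F_ij=(x_j,g_j)/(x_i,g_j) with (F_ij-1)(F_il-1)<0 on faces are assumed; there signs are 1 if all F_ij>0 and, for mu≤0, x is future-pointing. *)

(* Defs.v *)
From HB Require Import structures.
From mathcomp Require Import all_boot all_order all_algebra.
From mathcomp Require Import reals.
From mathcomp.real_closed Require Import complex.

Set Implicit Arguments.
Unset Strict Implicit.
Unset Printing Implicit Defensive.

Import Order.TTheory GRing.Theory Num.Theory.

Local Open Scope ring_scope.
Local Open Scope complex_scope.

Definition vertex : Type := (int * int)%type.

(* Edges and faces are taken inside a set D of vertices, so that the same
   notions serve for all of Z^2 (D = predT) and for a finite patch.  Edges are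
   listed in both directions, and a face in each of its eight cyclic
   labellings: the 4-cycles of Z^2 are exactly its elementary quadrilaterals. *)
Definition edge (D : pred vertex) (i j : vertex) : bool :=
  [&& D i, D j & `|i.1 - j.1| + `|i.2 - j.2| == 1].

Definition face (D : pred vertex) (i j k l : vertex) : bool :=
  [&& edge D i j, edge D j k, edge D k l, edge D l i, i != k & j != l].

Definition rectangle (p q : vertex) : pred vertex :=
  fun i => (p.1 <= i.1 <= q.1) && (p.2 <= i.2 <= q.2).

Definition mdot (R : realType) (u v : 'rV[R]_4) : R :=
  \sum_(n < 4) (if n == 0 then -1 else 1) * u 0 n * v 0 n.

Definition mx2 (C : nzRingType) (a b c d : C) : 'M[C]_2 :=
  \matrix_(i < 2, j < 2)
    if i == 0 then (if j == 0 then a else b) else (if j == 0 then c else d).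

Definition dagger (R : realType) (A : 'M[R[i]]_2) : 'M[R[i]]_2 :=
  \matrix_(i < 2, j < 2) (A j i)^*%R.

Definition hermE (R : realType) (n : 'I_4) : 'M[R[i]]_2 :=
  nth 0 [:: mx2 1 0 0 1; mx2 0 1 1 0; mx2 0 'i%C (- 'i%C) 0; mx2 1 0 0 (- 1)] n.

Definition herm (R : realType) (v : 'rV[R]_4) : 'M[R[i]]_2 :=
  \sum_(n < 4) (v 0 n)%:C *: hermE R n.

(* u /\ v in the second exterior power, realised as the antisymmetric
   4 x 4 matrices. *)
Definition wedge (R : realType) (u v : 'rV[R]_4) : 'M[R]_4 :=
  u^T *m v - v^T *m u.

Definition surface (R : realType) : Type := vertex -> 'rV[R]_4.

Definition planar (R : realType) (x : surface R) : Prop :=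
  forall i j k l, face predT i j k l ->
    (\dim <<[:: x j - x i; x k - x i; x l - x i]%R>> <= 2)%N.

Definition circular (R : realType) (x : surface R) : Prop :=
  planar x /\
  forall i j k l, face predT i j k l ->
    exists c : 'rV[R]_4,
      [/\ mdot (x i - c) (x i - c) = mdot (x j - c) (x j - c),
          mdot (x i - c) (x i - c) = mdot (x k - c) (x k - c) &
          mdot (x i - c) (x i - c) = mdot (x l - c) (x l - c)].

Definition edge_parallel (R : realType) (x y : surface R) : Prop :=
  forall i j, edge predT i j -> (\dim <<[:: x i - x j; y i - y j]%R>> <= 1)%N.

Definition mixed_area (R : realType) (x y : surface R) (i j k l : vertex) :
    'M[R]_4 :=
  4^-1 *: (wedge (x i - x k) (y j - y l) - wedge (x j - x l) (y i - y k)).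

Definition area_nondegenerate (R : realType) (x : surface R) : Prop :=
  forall i j k l, face predT i j k l -> mixed_area x x i j k l != 0.

Definition gauss_map (R : realType) : Type := vertex -> {vspace 'rV[R]_4}.

Definition null_line (R : realType) (U : {vspace 'rV[R]_4}) : Prop :=
  \dim U = 1%N /\ forall v, v \in U -> mdot v v = 0.

(* v \in L_i for L = x + G *)
Definition on_line (R : realType) (x : surface R) (G : gauss_map R)
    (i : vertex) (v : 'rV[R]_4) : bool :=
  v - x i \in G i.

(* L = x + G; the third clause is the standing assumption that the four lines
   of G at a face span a space of dimension at least 3. *)
Definition legendre (R : realType) (x : surface R) (G : gauss_map R) : Prop :=
  [/\ forall i, null_line (G i),
      forall i j, edge predT i j ->
        exists v, on_line x G i v /\ on_line x G j v &
      forall i j k l, face predT i j k l ->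
        (3 <= \dim (G i + G j + G k + G l)%VS)%N].

Definition nowhere_orthogonal (R : realType) (x : surface R) (G : gauss_map R) : Prop :=
  forall i, ~ (forall v, v \in G i -> mdot (x i) v = 0).

Definition section_G (R : realType) (G : gauss_map R) (g : surface R) : Prop :=
  forall i, g i != 0 /\ <[g i]>%VS = G i.

Definition section_L (R : realType) (x : surface R) (G : gauss_map R)
    (y : surface R) : Prop :=
  forall i, on_line x G i (y i).

Definition curvature_setting (R : realType) (mu : R) (x : surface R)
    (G : gauss_map R) : Prop :=
  [/\ circular x, legendre x G, nowhere_orthogonal x G &
      forall i, mdot (x i) (x i) = mu].

(* x has constant discrete mean curvature H in Q_mu (mu != 0), G being its
   hyperbolic Gauss map.  H is determined by this when A(x, x) != 0 on every face. *)
Definition constant_mean_curvature (R : realType) (mu : R) (x : surface R)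
    (G : gauss_map R) (H : R) : Prop :=
  curvature_setting mu x G /\
  exists g : surface R,
    let n : surface R := fun i => (Num.sqrt `|mu|)^-1 *: (g i - x i) in
    [/\ section_G G g,
        forall i, mdot (g i) (x i) = mu,
        edge_parallel x n &
        forall i j k l, face predT i j k l ->
          mixed_area x n i j k l + H *: mixed_area x x i j k l = 0].

Definition intrinsically_flat (R : realType) (x : surface R)
    (G : gauss_map R) : Prop :=
  curvature_setting 0 x G /\
  exists g : surface R,
    [/\ section_G G g, edge_parallel x g &
        forall i j k l, face predT i j k l -> mixed_area x g i j k l = 0].

Definition christoffel_dual (R : realType) (x y : surface R) : Prop :=
  [/\ edge_parallel x y, circular x, circular y &
      forall i j k l, face predT i j k l -> mixed_area x y i j k l = 0].

(* L = x + G is a Legendre immersion which is Omega-dual to G. *)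
Definition omega_dual (R : realType) (x : surface R) (G : gauss_map R) : Prop :=
  legendre x G /\
  exists y g : surface R,
    [/\ section_L x G y, section_G G g & christoffel_dual y g].

(* The cross ratio is nonzero by the second clause on faces, so none of the
   divisions is by zero and psi takes different values along each edge. *)
Definition discrete_holomorphic (R : realType) (D : pred vertex)
    (psi : vertex -> R[i]) (me : vertex -> vertex -> R) : Prop :=
  (forall i j, edge D i j -> me i j = me j i /\ me i j != 0) /\
  forall i j k l, face D i j k l ->
    [/\ me i j = me l k,
        me i l = me j k,
        (psi i - psi j) / (psi j - psi k) * ((psi k - psi l) / (psi l - psi i))
          = (me i l / me i j)%:C &
        me i l / me i j < 0].

(* s is a choice of square roots of the real edge function f, independent of
   the direction of an edge and equal on opposite edges of a face. *)
Definition edge_sqrt (R : realType) (D : pred vertex)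
    (f : vertex -> vertex -> R) (s : vertex -> vertex -> R[i]) : Prop :=
  (forall i j, edge D i j -> s i j ^+ 2 = (f i j)%:C /\ s i j = s j i) /\
  forall i j k l, face D i j k l -> s i j = s l k /\ s i l = s j k.

Definition Bmx (R : realType) (psi : vertex -> R[i])
    (me : vertex -> vertex -> R) (m : R) (s t : vertex -> vertex -> R[i])
    (i j : vertex) : 'M[R[i]]_2 :=
  let d := psi i - psi j in
  (d * s i j * t i j)^-1 *:
    mx2 ((me i j)%:C * d + m%:C * psi i)  (- (m%:C * psi i * psi j))
        (m%:C)                            ((me i j)%:C * d - m%:C * psi j).

Definition weierstrass_frame (R : realType) (D : pred vertex)
    (psi : vertex -> R[i]) (me : vertex -> vertex -> R) (m : R)
    (Psi : vertex -> 'M[R[i]]_2) : Prop :=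
  [/\ discrete_holomorphic D psi me,
      m != 0,
      forall i j, edge D i j -> me i j + m != 0,
      forall i, D i -> \det (Psi i) = 1 &
      exists s t : vertex -> vertex -> R[i],
        [/\ edge_sqrt D me s,
            edge_sqrt D (fun i j => me i j + m) t &
            forall i j, edge D i j ->
              Psi j = Psi i *m Bmx psi me m s t i j]].

(* Signs of the Hermitian representatives.  The product of the two square
   roots in B_ij is real when m_ij (m_ij + m) > 0 and imaginary otherwise.  In
   the second case X |-> B_ij X B_ij^* is minus the Lorentz transformation
   needed, which scales the null lines of psi_i and psi_j by 1 + m / m_ij and
   its inverse and is the identity on their orthogonal complement; it then
   destroys the incidence of L_i and L_j, and the sign has to be put back.
   If m_ij (m_ij + m) > 0 on all edges then eps = 1 is allowed. *)
Definition frame_sign (R : realType) (D : pred vertex)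
    (me : vertex -> vertex -> R) (m : R) (eps : vertex -> R) : Prop :=
  (forall i, D i -> eps i = 1 \/ eps i = - 1) /\
  forall i j, edge D i j -> eps j = eps i * Num.sg (me i j * (me i j + m)).

(* Hermitian matrix spanning the null line of phi = (a psi + b)/(c psi + d) *)
Definition gauss_mx (R : realType) (P : 'M[R[i]]_2) (z : R[i]) : 'M[R[i]]_2 :=
  let p := P 0 0 * z + P 0 1 in
  let q := P 1 0 * z + P 1 1 in
  if q == 0 then mx2 1 0 0 0
  else let phi := p / q in mx2 (`|phi| ^+ 2) phi phi^*%R 1.

Definition weierstrass_representation (R : realType) (D : pred vertex) (mu : R)
    (psi : vertex -> R[i]) (Psi : vertex -> 'M[R[i]]_2) (eps : vertex -> R)
    (x : surface R) (G : gauss_map R) : Prop :=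
  forall i, D i ->
    herm (x i) =
      (eps i)%:C *: (Psi i *m mx2 1 0 0 (- mu%:C) *m dagger (Psi i)) /\
    exists2 v, herm v = gauss_mx (Psi i) (psi i) & G i = <[v]>%VS.

(* (x_j, g_j) / (x_i, g_j) for a generator g_j of G_j.  For a surface given by
   weierstrass_representation it equals 1 + m / m_ij. *)
Definition edge_factor (R : realType) (x : surface R) (G : gauss_map R)
    (i j : vertex) : R :=
  mdot (x j) (vpick (G j)) / mdot (x i) (vpick (G j)).

(* By the preceding remark the inequalities below say that m_ij is finite and
   nonzero and that m_il / m_ij < 0, that is, they are necessary for x and G
   to come from a discrete holomorphic function. *)
Definition admissible (R : realType) (x : surface R) (G : gauss_map R) : Prop :=
  (forall i j, edge predT i j -> mdot (x i) (vpick (G j)) != 0) /\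
  forall i j k l, face predT i j k l ->
    (edge_factor x G i j - 1) * (edge_factor x G i l - 1) < 0.

(* Psi diag(1, -mu) Psi^* has positive trace when mu <= 0, and edge_factor is
   positive exactly when m_ij (m_ij + m) > 0: these conditions are necessary
   for a representation without signs. *)
Definition positively_oriented (R : realType) (mu : R) (x : surface R)
    (G : gauss_map R) : Prop :=
  (mu <= 0 -> forall i, 0 < x i 0 0) /\
  forall i j, edge predT i j -> 0 < edge_factor x G i j.

(* Main.v *)
Require Import Defs.
From HB Require Import structures.
From mathcomp Require Import all_boot all_order all_algebra.
From mathcomp Require Import reals.
From mathcomp Require boolp.
From mathcomp.real_closed Require Import complex.
From mathcomp Require Import ring lra zify.

Set Implicit Arguments.
Unset Strict Implicit.
Unset Printing Implicit Defensive.

Import Order.TTheory GRing.Theory Num.Theory.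

Local Open Scope ring_scope.
Local Open Scope complex_scope.

(** A null vector is a real multiple of $ww^\dagger$ for a spinor $w\in\mathbb C^2$, and pairing $x$
    with it is, up to the factor $-\frac12$, evaluating a Hermitian form at $w$ ([mdot_nv]). In
    these terms $G_i$ is spanned by the null vector of $w_i=\Psi_i(\psi_i,1)^T$, and $B_{ij}$ is the
    matrix with eigenvectors $(\psi_i,1)$ and $(\psi_j,1)$ and eigenvalues $1/z$ and $z$, where
    $z^2=m_{ij}/(m_{ij}+m)$.

    From $\psi$ to $x$. Let $g_i$ be the generator of $G_i$ with $(g_i,x_i)=-\frac12$. Comparing the
    forms of $x_i$ and $x_j$ in the basis $w_i,w_j$ shows that $dx$ is a multiple of $dg$
    ([edge_formula]). Since the cross ratio is real, the four null lines of a face satisfy an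
    explicit linear relation ([concircular]). Written in the $g$'s, it is an affine relation
    ([rho_face]), and together with the edge formula it makes the diagonal $g_k-g_i$ parallel to the
    opposite diagonal $x_j-x_l$ ([face_dual]). Two surfaces in quadrics with parallel edges and
    parallel opposite diagonals are Christoffel dual ([quadric_christoffel_dual]). Hence $x\in\Gamma
    L$ and $g$ exhibit the $\Omega$-duality. The equation $A(x,g)=0$ is flatness if $\mu=0$; if
    $\mu\ne0$, rescaling $g$ to $(g,x)=\mu$ turns it into $A(x,n)=-A(x,x)/\sqrt{|\mu|}$.

    From $x$ to $\psi$. The curvature condition again means $A(x,g)=0$ ([gauss_section]). This
    forces opposite diagonals to be parallel ([face_diagonal]), so the edge factor $\lambda$ agrees
    on opposite edges ([face_factor]), and the cross ratio of the spinors of $G$ is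
    $\tau_{ij}/\tau_{il}$ with $\tau=1-1/\lambda$ ([face_cross_spinor]). The matrix $T_{ij}$ with
    eigenvectors $w_i,w_j$ and eigenvalues $1/z,z$ carries the Hermitian matrix of $x_i$ to that of
    $x_j$ up to the sign of $\lambda$ ([herm_transport]), and the cross ratio condition makes these
    matrices close up around faces ([transport_face]). So $\Psi_j=T_{ij}\Psi_i$ can be integrated
    over a rectangle ([flat_section]) from an initial frame ([hermitian_frame]), and $\psi_i$ is the
    affine coordinate of $\Psi_i^{-1}w_i$, kept finite by [finite_frame]. *)

Ltac nz := repeat (apply/andP; split); first [assumption | by rewrite ?fmorph_eq0].

(** * Spinors: the determinant pairing and Hermitian forms on $\mathbb C^2$ *)

Section Spinors.
Context {R : realType}.
Local Notation C := R[i].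
Implicit Types (u v w : 'cV[C]_2) (M N P : 'M[C]_2) (a b : C).

Definition sp (p q : C) : 'cV[C]_2 := \col_n (if n == 0 then p else q).
Definition br (u v : 'cV[C]_2) : C := u 0 0 * v 1 0 - u 1 0 * v 0 0.
(** The squared modulus as an element of [R]: the norm of [R[i]] takes its values in [R[i]]. *)
Definition nsq (a : C) : R := complex.Re a ^+ 2 + complex.Im a ^+ 2.
Definition outer (u v : 'cV[C]_2) : 'M[C]_2 := \matrix_(m, n) (u m 0 * (v n 0)^*%R).
(** This is the sesquilinear form of [M] precomposed with the rotation $(u_0,u_1)\mapsto(u_1,-u_0)$.
    With this twist it is invariant under $M\mapsto PMP^\dagger$, $u\mapsto Pu$ for $\det P=1$
    ([hqM]), and on null vectors it gives the Minkowski product ([mdot_nv]). *)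
Definition hq (M : 'M[C]_2) (u v : 'cV[C]_2) : C :=
  u 1 0 * M 0 0 * (v 1 0)^*%R - u 1 0 * M 0 1 * (v 0 0)^*%R
  - u 0 0 * M 1 0 * (v 1 0)^*%R + u 0 0 * M 1 1 * (v 0 0)^*%R.

Lemma conjcE (a : C) : a^*%R = conjc a. Proof. by []. Qed.
Lemma conjR (c : R) : (c%:C)^*%R = c%:C :> C. Proof. exact: conjc_real. Qed.

Lemma nsqE a : (nsq a)%:C = a * a^*%R.
Proof. by rewrite /nsq add_Re2_Im2 sqr_normc. Qed.
Lemma nsq_real (c : R) : nsq c%:C = c ^+ 2.
Proof. by rewrite /nsq /= expr0n addr0. Qed.
Lemma nsqM a b : nsq (a * b) = nsq a * nsq b.
Proof. apply: complexI; rewrite rmorphM /= !nsqE; ring. Qed.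
Lemma nsqN a : nsq (- a) = nsq a.
Proof. by apply: complexI; rewrite !nsqE rmorphN mulrNN. Qed.
Lemma nsq_eq0 a : (nsq a == 0) = (a == 0).
Proof.
apply/eqP/eqP => [h|->]; last by rewrite /nsq /= expr0n addr0.
have := nsqE a; rewrite h => /esym/eqP; rewrite mulf_eq0 fmorph_eq0 orbb.
by move/eqP.
Qed.
Lemma nsq_ge0 a : 0 <= nsq a.
Proof. by rewrite addr_ge0 // sqr_ge0. Qed.

Lemma mx2P M N : M 0 0 = N 0 0 -> M 0 1 = N 0 1 -> M 1 0 = N 1 0 ->
  M 1 1 = N 1 1 -> M = N.
Proof.
move=> h00 h01 h10 h11; apply/matrixP => m n.
have E (k : 'I_2) : k = 0 \/ k = 1.
  by case: k => [[|[|//]] lt]; [left|right]; exact: val_inj.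
by case: (E m) => ->; case: (E n) => ->.
Qed.
Lemma cv2P u v : u 0 0 = v 0 0 -> u 1 0 = v 1 0 -> u = v.
Proof.
move=> h0 h1; apply/matrixP => m n; rewrite ord1.
have E (k : 'I_2) : k = 0 \/ k = 1.
  by case: k => [[|[|//]] lt]; [left|right]; exact: val_inj.
by case: (E m) => ->.
Qed.
Lemma mul2E m n (A : 'M[C]_(m, 2)) (B : 'M[C]_(2, n)) k l :
  (A *m B) k l = A k 0 * B 0 l + A k 1 * B 1 l.
Proof. by rewrite mxE big_ord_recl big_ord1 /=; congr (_ + _ * _); congr (_ _ _); exact: val_inj. Qed.
Lemma det2E M : \det M = M 0 0 * M 1 1 - M 0 1 * M 1 0.
Proof.
rewrite (expand_det_row M 0) big_ord_recl big_ord1 /= /cofactor !det_mx11 !mxE /=.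
have -> : lift (0 : 'I_2) 0 = 1 by exact: val_inj.
have -> : lift (1 : 'I_2) 0 = 0 by exact: val_inj.
rewrite expr0 expr1; ring.
Qed.

Lemma sp0 p q : sp p q 0 0 = p. Proof. by rewrite mxE. Qed.
Lemma sp1 p q : sp p q 1 0 = q. Proof. by rewrite mxE. Qed.

Lemma br_anti u v : br u v = - br v u. Proof. rewrite /br; ring. Qed.
Lemma br_self u : br u u = 0. Proof. rewrite /br; ring. Qed.
Lemma brZl a u v : br (a *: u) v = a * br u v. Proof. rewrite /br !mxE; ring. Qed.
Lemma brZr a u v : br u (a *: v) = a * br u v. Proof. rewrite /br !mxE; ring. Qed.
Lemma brM M u v : br (M *m u) (M *m v) = \det M * br u v.
Proof. rewrite /br !mul2E det2E; ring. Qed.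
Lemma plucker u v w : br u v *: w + br v w *: u + br w u *: v = 0.
Proof. by apply: cv2P; rewrite !mxE /br; ring. Qed.
Lemma br_eq0 u v : u != 0 -> br u v = 0 -> exists a, v = a *: u.
Proof.
move=> u0; rewrite /br => /eqP; rewrite subr_eq0 => /eqP h.
have [e|n0] := eqVneq (u 0 0) 0; last first.
  exists (v 0 0 / u 0 0); apply: cv2P; rewrite !mxE; first by field.
  by apply: (mulfI n0); rewrite h; field.
have [e1|n1] := eqVneq (u 1 0) 0.
  by case/eqP: u0; apply: cv2P; rewrite mxE.
exists (v 1 0 / u 1 0); apply: cv2P; rewrite !mxE; last by field.
by apply: (mulfI n1); rewrite -h; field.
Qed.

Lemma hqD M N u v : hq (M + N) u v = hq M u v + hq N u v.
Proof. rewrite /hq !mxE; ring. Qed.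
Lemma hqZ a M u v : hq (a *: M) u v = a * hq M u v.
Proof. rewrite /hq !mxE; ring. Qed.
Lemma hqN M u v : hq (- M) u v = - hq M u v.
Proof. by rewrite -scaleN1r hqZ mulN1r. Qed.
Lemma hqZl a M u v : hq M (a *: u) v = a * hq M u v.
Proof. rewrite /hq !mxE; ring. Qed.
Lemma hqZr a M u v : hq M u (a *: v) = a^*%R * hq M u v.
Proof. rewrite /hq !mxE; ring. Qed.
Lemma hq_outer u v w t : hq (outer u v) w t = br w u * (br t v)^*%R.
Proof. rewrite /hq /br !mxE; ring. Qed.
Lemma daggerE M m n : dagger M m n = (M n m)^*%R. Proof. by rewrite mxE. Qed.
Lemma daggerM M N : dagger (M *m N) = dagger N *m dagger M.
Proof. apply: mx2P; rewrite !(mul2E, mxE); ring. Qed.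
Lemma hqM P M u v :
  hq (P *m M *m dagger P) (P *m u) (P *m v) = \det P * (\det P)^*%R * hq M u v.
Proof.
rewrite /hq !mul2E !daggerE det2E !rmorphB; ring.
Qed.
Lemma outerM P u v : P *m outer u v *m dagger P = outer (P *m u) (P *m v).
Proof. apply: mx2P; rewrite !(mul2E, mxE); ring. Qed.
Lemma outerZ a u : outer (a *: u) (a *: u) = (nsq a)%:C *: outer u u.
Proof. by apply: mx2P; rewrite !mxE nsqE; ring. Qed.

Lemma hqDl M u v w : hq M (u + v) w = hq M u w + hq M v w.
Proof. rewrite /hq !mxE; ring. Qed.
Lemma hqDr M u v w : hq M u (v + w) = hq M u v + hq M u w.
Proof. rewrite /hq !mxE; ring. Qed.

Lemma br_span u v w : br u v != 0 ->
  w = (br w v / br u v) *: u + (br u w / br u v) *: v.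
Proof.
move=> h; apply: (scalerI h); rewrite scalerDr !scalerA.
have E a : br u v * (a / br u v) = a by field.
rewrite !E; apply: cv2P; rewrite !mxE /br; ring.
Qed.

(** A sesquilinear form is determined by its values on a basis. Hermitian matrices at the two ends
    of an edge are compared in this way, in the basis of the two spinors of the edge. *)
Lemma hq_inj M N u v : br u v != 0 -> hq M u u = hq N u u ->
  hq M u v = hq N u v -> hq M v u = hq N v u -> hq M v v = hq N v v -> M = N.
Proof.
move=> h0 h1 h2 h3 h4.
have S w t : hq M w t = hq N w t.
  rewrite (br_span w h0) (br_span t h0) !(hqDl, hqDr, hqZl, hqZr).
  by rewrite h1 h2 h3 h4.
have E00 (L : 'M[C]_2) : L 0 0 = hq L (sp 0 1) (sp 0 1).
  rewrite /hq !sp0 !sp1; ring.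
have E01 (L : 'M[C]_2) : L 0 1 = - hq L (sp 0 1) (sp 1 0).
  rewrite /hq !sp0 !sp1; ring.
have E10 (L : 'M[C]_2) : L 1 0 = - hq L (sp 1 0) (sp 0 1).
  rewrite /hq !sp0 !sp1; ring.
have E11 (L : 'M[C]_2) : L 1 1 = hq L (sp 1 0) (sp 1 0).
  rewrite /hq !sp0 !sp1; ring.
by apply: mx2P; rewrite ?(E00 M) ?(E01 M) ?(E10 M) ?(E11 M) S -?E00 -?E01 -?E10 -?E11.
Qed.
End Spinors.

(** * The Hermitian model and null vectors as squares of spinors *)

Section Hermitian.
Context {R : realType}.
Local Notation C := R[i].
Implicit Types (u v w : 'cV[C]_2) (M N P : 'M[C]_2) (x y : 'rV[R]_4).

Lemma sum4 (V : nmodType) (F : 'I_4 -> V) :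
  \sum_n F n = F 0 + F 1 + F (inord 2) + F (inord 3).
Proof.
rewrite !big_ord_recl big_ord0 /= addr0 !addrA; congr (_ + F _ + F _ + F _).
- exact: val_inj.
- by apply: val_inj; rewrite /= inordK.
- by apply: val_inj; rewrite /= inordK.
Qed.

Definition vec4 (a b c d : R) : 'rV[R]_4 := \row_n nth 0 [:: a; b; c; d] n.
Lemma vec4E a b c d : [/\ vec4 a b c d 0 0 = a, vec4 a b c d 0 1 = b,
  vec4 a b c d 0 (inord 2) = c & vec4 a b c d 0 (inord 3) = d].
Proof. by split; rewrite mxE ?inordK. Qed.

Lemma rV4P x y : x 0 0 = y 0 0 -> x 0 1 = y 0 1 ->
  x 0 (inord 2) = y 0 (inord 2) -> x 0 (inord 3) = y 0 (inord 3) -> x = y.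
Proof.
move=> h0 h1 h2 h3; apply/rowP => n.
have -> : n = inord n by apply: val_inj; rewrite /= inordK.
case: n => [[|[|[|[|//]]]] lt] //=.
- by have -> : (inord 0 : 'I_4) = 0 by apply: val_inj; rewrite /= inordK.
- by have -> : (inord 1 : 'I_4) = 1 by apply: val_inj; rewrite /= inordK.
Qed.

Lemma mdotE x y : mdot x y = - (x 0 0 * y 0 0) + x 0 1 * y 0 1
  + x 0 (inord 2) * y 0 (inord 2) + x 0 (inord 3) * y 0 (inord 3).
Proof.
rewrite /mdot sum4 /=.
have -> : ((inord 2 : 'I_4) == 0) = false by rewrite -val_eqE /= inordK.
have -> : ((inord 3 : 'I_4) == 0) = false by rewrite -val_eqE /= inordK.
ring.
Qed.

Lemma mdotC x y : mdot x y = mdot y x.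
Proof. rewrite !mdotE; ring. Qed.
Lemma mdotDl x y z : mdot (x + y) z = mdot x z + mdot y z.
Proof. rewrite !mdotE !mxE; ring. Qed.
Lemma mdotBl x y z : mdot (x - y) z = mdot x z - mdot y z.
Proof. rewrite !mdotE !mxE; ring. Qed.
Lemma mdotZl c x z : mdot (c *: x) z = c * mdot x z.
Proof. rewrite !mdotE !mxE; ring. Qed.
Lemma mdotDr x y z : mdot z (x + y) = mdot z x + mdot z y.
Proof. by rewrite ![mdot z _]mdotC mdotDl. Qed.
Lemma mdotBr x y z : mdot z (x - y) = mdot z x - mdot z y.
Proof. by rewrite ![mdot z _]mdotC mdotBl. Qed.
Lemma mdotZr c x z : mdot z (c *: x) = c * mdot z x.
Proof. by rewrite ![mdot z _]mdotC mdotZl. Qed.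
Lemma mdot0r x : mdot x 0 = 0.
Proof. by rewrite -(scale0r x) mdotZr mul0r. Qed.

Lemma hermEx x :
  [/\ herm x 0 0 = (x 0 0)%:C + (x 0 (inord 3))%:C,
      herm x 0 1 = (x 0 1)%:C + 'i%C * (x 0 (inord 2))%:C,
      herm x 1 0 = (x 0 1)%:C - 'i%C * (x 0 (inord 2))%:C &
      herm x 1 1 = (x 0 0)%:C - (x 0 (inord 3))%:C].
Proof.
rewrite /herm sum4 /hermE !inordK //=; split; rewrite !mxE /=; ring.
Qed.

Lemma hermD x y : herm (x + y) = herm x + herm y.
Proof. by rewrite /herm -big_split; apply: eq_bigr => n _; rewrite mxE rmorphD scalerDl. Qed.
Lemma hermZ c x : herm (c *: x) = c%:C *: herm x.
Proof. by rewrite /herm scaler_sumr; apply: eq_bigr => n _; rewrite mxE rmorphM scalerA. Qed.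
Lemma herm0 : herm 0 = 0 :> 'M[C]_2.
Proof. by rewrite -(scale0r 0) hermZ rmorph0 scale0r. Qed.
Lemma hermN x : herm (- x) = - herm x.
Proof. by rewrite -scaleN1r hermZ rmorphN1 scaleN1r. Qed.
Lemma hermB x y : herm (x - y) = herm x - herm y.
Proof. by rewrite hermD hermN. Qed.

Lemma dagger_herm x : dagger (herm x) = herm x.
Proof.
have [h00 h01 h10 h11] := hermEx x.
have conjE (a : C) : a^*%R = conjc a by [].
apply: mx2P; rewrite daggerE ?h00 ?h01 ?h10 ?h11 conjE;
  apply/eqP; rewrite eq_complex /=; apply/andP; split; apply/eqP; ring.
Qed.

Lemma herm_inj : injective (@herm R).
Proof.
move=> x y e.
have [x00 x01 x10 x11] := hermEx x; have [y00 y01 y10 y11] := hermEx y.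
have e00 : herm x 0 0 = herm y 0 0 by rewrite e.
have e01 : herm x 0 1 = herm y 0 1 by rewrite e.
have e11 : herm x 1 1 = herm y 1 1 by rewrite e.
move: e00 e01 e11; rewrite x00 x01 x11 y00 y01 y11.
move=> /eqP; rewrite eq_complex /= => /andP[/eqP h00 _].
move=> /eqP; rewrite eq_complex /= => /andP[/eqP h01 /eqP h01'].
move=> /eqP; rewrite eq_complex /= => /andP[/eqP h11 _].
by apply: rV4P; lra.
Qed.

Definition unherm (M : 'M[C]_2) : 'rV[R]_4 :=
  vec4 (complex.Re (M 0 0 + M 1 1) / 2) (complex.Re (M 0 1)) (complex.Im (M 0 1))
       (complex.Re (M 0 0 - M 1 1) / 2).

Lemma unhermK M : dagger M = M -> herm (unherm M) = M.
Proof.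
move=> hM.
have h00 : M 0 0 = (M 0 0)^*%R by rewrite -daggerE hM.
have h11 : M 1 1 = (M 1 1)^*%R by rewrite -daggerE hM.
have h10 : M 1 0 = (M 0 1)^*%R by rewrite -daggerE hM.
have [e0 e1 e2 e3] := vec4E (complex.Re (M 0 0 + M 1 1) / 2)
  (complex.Re (M 0 1)) (complex.Im (M 0 1)) (complex.Re (M 0 0 - M 1 1) / 2).
have [x00 x01 x10 x11] := hermEx (unherm M).
move: x00 x01 x10 x11; rewrite /unherm e0 e1 e2 e3 => x00 x01 x10 x11.
apply: mx2P; rewrite ?x00 ?x01 ?x10 ?x11 ?h10.
- move: h00; case: (M 0 0) => a b; case: (M 1 1) => c d.
  move=> /eqP; rewrite eq_complex /= => /andP[_ /eqP hb].
  apply/eqP; rewrite eq_complex /=; apply/andP; split; apply/eqP; lra.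
- case: (M 0 1) => a b; apply/eqP; rewrite eq_complex /=; apply/andP; split; apply/eqP; ring.
- case: (M 0 1) => a b; apply/eqP; rewrite eq_complex /=; apply/andP; split; apply/eqP; ring.
- move: h11; case: (M 0 0) => a b; case: (M 1 1) => c d.
  move=> /eqP; rewrite eq_complex /= => /andP[_ /eqP hb].
  apply/eqP; rewrite eq_complex /=; apply/andP; split; apply/eqP; lra.
Qed.

Definition nv (w : 'cV[C]_2) : 'rV[R]_4 := unherm (outer w w).

Lemma herm_nv w : herm (nv w) = outer w w.
Proof.
by apply: unhermK; apply/matrixP => m n; rewrite !mxE rmorphM /= conjCK mulrC.
Qed.

Lemma nvZ a w : nv (a *: w) = nsq a *: nv w.
Proof. by apply: herm_inj; rewrite hermZ !herm_nv outerZ. Qed.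

Lemma mdot_herm x y : (mdot x y)%:C = - 2^-1 *
  (herm x 0 0 * herm y 1 1 + herm x 1 1 * herm y 0 0
   - herm x 0 1 * herm y 1 0 - herm x 1 0 * herm y 0 1).
Proof.
have [-> -> -> ->] := hermEx x; have [-> -> -> ->] := hermEx y.
rewrite mdotE !(rmorphD, rmorphN, rmorphM) /=.
have i2 := @sqr_i R.
have E (i a b c d e f g h : C) : i ^+ 2 = -1 -> - (a * b) + c * d + e * f + g * h
  = - 2^-1 * ((a + g) * (b - h) + (a - g) * (b + h)
              - (c + i * e) * (d - i * f) - (c - i * e) * (d + i * f)).
  move=> hi; transitivity (- (a * b) + c * d - i ^+ 2 * e * f + g * h); first by rewrite hi; ring.
  by field.
exact: E.
Qed.

Lemma mdot_nv x w : (mdot x (nv w))%:C = - 2^-1 * hq (herm x) w w.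
Proof. rewrite mdot_herm herm_nv /hq !mxE; ring. Qed.

Lemma mdot_nvnv u w : mdot (nv u) (nv w) = - 2^-1 * nsq (br u w).
Proof.
apply: complexI; rewrite mdot_nv herm_nv hq_outer rmorphM rmorphN /= nsqE.
by rewrite fmorphV rmorph_nat br_anti rmorphN mulrNN.
Qed.

Lemma det_herm x : \det (herm x) = (- mdot x x)%:C.
Proof. rewrite det2E rmorphN /= mdot_herm; field; rewrite ?pnatr_eq0 //. Qed.

Lemma nv_eq0 w : (nv w == 0) = (w == 0).
Proof.
apply/eqP/eqP => [h|->]; last first.
  by rewrite -(scale0r 0) nvZ nsq_real expr0n scale0r.
have : outer w w = 0 by rewrite -herm_nv h -(scale0r 0) hermZ rmorph0 scale0r.
move/matrixP => E; apply: cv2P; rewrite mxE; apply/eqP; rewrite -nsq_eq0.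
  by have := E 0 0; rewrite !mxE -nsqE => /eqP; rewrite fmorph_eq0.
by have := E 1 1; rewrite !mxE -nsqE => /eqP; rewrite fmorph_eq0.
Qed.

(** A null vector has a Hermitian matrix of determinant zero, hence of rank one. The real factor [c]
    is needed because the vector may point to the past. *)
Lemma null_nv x : mdot x x = 0 -> x != 0 ->
  exists c w, [/\ c != 0, w != 0 & x = c *: nv w].
Proof.
move=> xx x0.
have hd : \det (herm x) = 0 by rewrite det_herm xx oppr0.
have hx := dagger_herm x.
have h10 : herm x 1 0 = (herm x 0 1)^*%R by rewrite -daggerE hx.
move: hd; rewrite det2E => /eqP; rewrite subr_eq0 => /eqP hd.
have [h00 _ _ h11] := hermEx x; rewrite -!rmorphD in h00; rewrite -rmorphB in h11.
move: (_ + _) (_ - _) h00 h11 => /= a c h00 h11.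
have sp_neq (p q : C) : (p != 0) || (q != 0) -> sp p q != 0.
  apply: contraTneq => e; rewrite negb_or !negbK.
  by rewrite -[X in X == 0](sp0 p q) -[X in _ && (X == 0)](sp1 p q) e !mxE eqxx.
have [a0|a0] := eqVneq a 0.
  have b0 : herm x 0 1 = 0.
    move: hd; rewrite h00 a0 mul0r h10 -nsqE => /esym/eqP.
    by rewrite fmorph_eq0 nsq_eq0 => /eqP.
  have [c0|c0] := eqVneq c 0.
    case/eqP: x0; apply: herm_inj; rewrite -(scale0r 0) hermZ rmorph0 scale0r.
    by apply: mx2P; rewrite ?h00 ?h11 ?h10 ?b0 ?a0 ?c0 ?rmorph0 mxE.
  exists c, (sp 0 1); split=> //; first by rewrite sp_neq // oner_eq0 orbT.
  apply: herm_inj; rewrite hermZ herm_nv.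
  by apply: mx2P; rewrite ?h00 ?h11 ?h10 ?b0 ?a0 ![in RHS]mxE /= ?conjC0 ?conjC1 ?mulr0 ?mulr1 ?mul0r ?mulr0.
have aC : a%:C != 0 :> C by rewrite fmorph_eq0.
exists a, (sp 1 (herm x 1 0 / a%:C)); split=> //; first by rewrite sp_neq // oner_eq0.
apply: herm_inj; rewrite hermZ herm_nv.
apply: mx2P; rewrite ![in RHS]mxE /= ?conjC1 ?mulr1 ?mul1r ?h00 //.
- by rewrite h10 rmorphM /= conjCK fmorphV /= conjR; field.
- by field.
- apply: (mulfI aC); rewrite -h00 hd h00 h10 !rmorphM /= conjCK fmorphV /= conjR; field.
  exact: aC.
Qed.
End Hermitian.

(** * Spans, wedge products, faces of the lattice and Christoffel duality *)

Section Geometry.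
Context {R : realType}.
Local Notation C := R[i].
Implicit Types (u v p q x y : 'rV[R]_4).

Lemma dim_span_le (V : vectType R) (s t : seq V) :
  {in s, forall z, z \in <<t>>%VS} -> (\dim <<s>> <= size t)%N.
Proof. by move/span_subvP/dimvS/leq_trans; apply; apply: dim_span. Qed.

Lemma dim_span2_le1 u v c : v = c *: u -> (\dim <<[:: u; v]>> <= 1)%N.
Proof.
move=> ->; apply: (@dim_span_le _ _ [:: u]) => y; rewrite !inE span_seq1.
by case/orP => /eqP ->; rewrite ?memvZ ?memv_line.
Qed.

Lemma dim_span2_le1P u v : u != 0 -> (\dim <<[:: u; v]>> <= 1)%N ->
  exists c, v = c *: u.
Proof.
move=> u0 d; apply/vlineP; rewrite -span_seq1; apply: contraLR d => nv.
have fr : free [:: v; u] by rewrite free_cons nv seq1_free.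
rewrite (@eq_span _ _ _ [:: v; u]); first by move: fr; rewrite /free => /eqP ->.
by move=> y; rewrite !inE orbC.
Qed.

Lemma dim_span_le2P p q (s : seq 'rV[R]_4) : free [:: p; q] ->
  p \in <<s>>%VS -> q \in <<s>>%VS -> (\dim <<s>> <= 2)%N ->
  forall v, v \in <<s>>%VS -> exists a b, v = a *: p + b *: q.
Proof.
move=> fr hp hq d v hv.
have e : <<[:: p; q]>>%VS = <<s>>%VS.
  apply/eqP; rewrite eqEdim; apply/andP; split.
    by apply/span_subvP => y; rewrite !inE => /orP[] /eqP ->.
  by move: fr; rewrite /free => /eqP ->.
move: hv; rewrite -e span_cons span_seq1 => /memv_addP[y hy [z hz ->]].
by have /vlineP[a ->] := hy; have /vlineP[b ->] := hz; exists a, b.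
Qed.

Lemma wedgeDl x y v : wedge (x + y) v = wedge x v + wedge y v.
Proof. by rewrite /wedge linearD /= mulmxDl mulmxDr opprD addrACA. Qed.
Lemma wedgeZl c x v : wedge (c *: x) v = c *: wedge x v.
Proof. by rewrite /wedge linearZ /= -scalemxAl -scalemxAr scalerBr. Qed.
Lemma wedgeC x y : wedge x y = - wedge y x.
Proof. by rewrite /wedge opprB. Qed.
Lemma wedgeDr x y v : wedge v (x + y) = wedge v x + wedge v y.
Proof. by rewrite ![wedge v _]wedgeC wedgeDl opprD. Qed.
Lemma wedgeZr c x v : wedge v (c *: x) = c *: wedge v x.
Proof. by rewrite ![wedge v _]wedgeC wedgeZl scalerN. Qed.
Lemma wedge_self x : wedge x x = 0.
Proof. by rewrite /wedge subrr. Qed.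
Lemma wedgeBr x y v : wedge v (x - y) = wedge v x - wedge v y.
Proof. by rewrite -scaleN1r wedgeDr wedgeZr scaleN1r. Qed.

Lemma wedge_neq0 p q : wedge p q != 0 -> free [:: p; q].
Proof.
move=> h; rewrite free_cons seq1_free span_seq1; apply/andP; split.
  apply: contraNN h => /vlineP[c ->].
  by rewrite wedgeZl wedge_self scaler0.
by apply: contraNneq h => ->; rewrite -(scale0r 0) wedgeZr scale0r.
Qed.

Lemma free2P p q a b : free [:: p; q] -> a *: p + b *: q = 0 -> a = 0 /\ b = 0.
Proof.
rewrite free_cons span_seq1 seq1_free => /andP[hp hq] e.
have a0 : a = 0.
  apply: contraNeq hp => a0; apply/vlineP; exists (- (a^-1 * b)).
  apply: (scalerI a0); rewrite scaleNr scalerN scalerA mulrA mulfV // mul1r.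
  by apply/eqP; rewrite -addr_eq0 e.
split=> //; move: e; rewrite a0 scale0r add0r => /eqP.
by rewrite scaler_eq0 (negPf hq) orbF => /eqP.
Qed.

Lemma free2_eq p q a b c d : free [:: p; q] ->
  a *: p + b *: q = c *: p + d *: q -> a = c /\ b = d.
Proof.
move=> fr e; have : (a - c) *: p + (b - d) *: q = 0.
  by rewrite !scalerBl addrACA -opprD e subrr.
by case/(free2P fr) => /subr0_eq -> /subr0_eq ->.
Qed.

Lemma edge_sym D i j : edge D i j = edge D j i.
Proof. by rewrite /edge !(distrC i.1) !(distrC i.2) andbCA. Qed.

Lemma face_edges D i j k l : face D i j k l ->
  [/\ edge D i j, edge D j k, edge D k l, edge D l i & edge D l k] /\ edge D i l.
Proof.
by case/and5P => e1 e2 e3 e4 _; rewrite (edge_sym D l k) (edge_sym D i l).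
Qed.

Lemma face_rot D i j k l : face D i j k l -> face D j k l i.
Proof. by case/and5P => e1 e2 e3 e4 /andP[n1 n2]; rewrite /face e1 e2 e3 e4 n2 eq_sym. Qed.

Lemma face_refl D i j k l : face D i j k l -> face D i l k j.
Proof.
case/and5P => e1 e2 e3 e4 /andP[n1 n2]; rewrite /face !(edge_sym D i l, edge_sym D l k, edge_sym D k j, edge_sym D j i).
by rewrite e1 e2 e3 e4 n1 eq_sym.
Qed.

(** Negativity of cross ratios and of [admissible] is imposed on faces only; its consequences for
    single edges are drawn through a face containing the edge. *)
Lemma edge_face i j : edge predT i j -> exists k l, face predT i j k l.
Proof.
case: i j => i1 i2 [j1 j2]; rewrite /edge /= => h.
have [e|n] := eqVneq i1 j1.
  exists (j1 + 1, j2), (i1 + 1, i2); rewrite /face /edge /= -!pair_eqE /pair_eq /=.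
  by move: h; rewrite e; lia.
exists (j1, j2 + 1), (i1, i2 + 1); rewrite /face /edge /= -!pair_eqE /pair_eq /=.
by move: h n; lia.
Qed.

Lemma edge_pred (D : pred vertex) i j : edge D i j -> edge predT i j /\ D i /\ D j.
Proof. by case/and3P => ? ? e; rewrite /edge e. Qed.

Lemma face_pred (D : pred vertex) i j k l : face D i j k l -> face predT i j k l.
Proof.
case/and5P => /edge_pred[e1 _] /edge_pred[e2 _] /edge_pred[e3 _] /edge_pred[e4 _] n.
by rewrite /face e1 e2 e3 e4.
Qed.

Lemma circular_in_quadric (x : surface R) (c : R) :
  planar x -> (forall i, mdot (x i) (x i) = c) -> circular x.
Proof. by move=> hp hc; split=> // i j k l _; exists 0; rewrite !subr0 !hc. Qed.

(** The mixed area is a combination of $\delta x_{ik}\wedge\delta g_{jl}$ and $\delta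
    x_{jl}\wedge\delta g_{ik}$, and both vanish when opposite diagonals are parallel. Planarity
    follows too: a diagonal of one surface is a multiple of a diagonal of the other, which is a
    combination of the edges at [i]. A planar surface in a quadric centred at 0 is circular. *)
Lemma quadric_christoffel_dual (x g : surface R) (mu nu : R) :
  (forall i, mdot (x i) (x i) = mu) -> (forall i, mdot (g i) (g i) = nu) ->
  (forall i j, edge predT i j -> exists2 c, c != 0 & x j - x i = c *: (g i - g j)) ->
  (forall i j k l, face predT i j k l -> exists r, g k - g i = r *: (x j - x l)) ->
  (forall i j k l, face predT i j k l -> g j != g l) ->
  christoffel_dual x g.
Proof.
move=> hx hg E D N; split.
- move=> i j e; have e' : edge predT j i by rewrite edge_sym.
  have [c c0 h] := E j i e'; apply: (@dim_span2_le1 _ _ (- c^-1)).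
  by rewrite h scalerA mulNr mulVf // scaleN1r opprB.
- apply: circular_in_quadric hx => i j k l f.
  have [[eij _ _ _ _] eil] := face_edges f.
  have [c1 c10 h1] := E i j eij; have [c2 c20 h2] := E i l eil.
  (* The rotated face gives the other pair of diagonals, $g_l-g_j=r\,(x_k-x_i)$. *)
  have [r hr] := D _ _ _ _ (face_rot f).
  have r0 : r != 0.
    apply: contraNneq (N _ _ _ _ f) => r0; move: hr; rewrite r0 scale0r.
    by move/eqP; rewrite subr_eq0 eq_sym.
  apply: (@dim_span_le _ _ [:: x j - x i; x l - x i]) => v.
  have ha : x j - x i \in <<[:: x j - x i; x l - x i]>>%VS by rewrite memv_span ?mem_head.
  have hb : x l - x i \in <<[:: x j - x i; x l - x i]>>%VS by rewrite memv_span ?inE ?eqxx ?orbT.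
  rewrite !inE => /or3P[] /eqP -> //.
  have -> : x k - x i = (r^-1 * c1^-1) *: (x j - x i) - (r^-1 * c2^-1) *: (x l - x i).
    apply: (scalerI r0); rewrite [RHS]scalerBr !scalerA !mulrA mulfV // !mul1r -hr h1 h2.
    by rewrite !scalerA !mulVf // !scale1r; apply/rowP => n; rewrite !mxE; ring.
  by rewrite memvB ?memvZ.
- apply: circular_in_quadric hg => i j k l f.
  have [[eij _ _ _ _] eil] := face_edges f.
  have [c1 c10 h1] := E i j eij; have [c2 c20 h2] := E i l eil.
  have [r hr] := D _ _ _ _ f.
  apply: (@dim_span_le _ _ [:: g j - g i; g l - g i]) => v.
  have ha : g j - g i \in <<[:: g j - g i; g l - g i]>>%VS by rewrite memv_span ?mem_head.
  have hb : g l - g i \in <<[:: g j - g i; g l - g i]>>%VS by rewrite memv_span ?inE ?eqxx ?orbT.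
  rewrite !inE => /or3P[] /eqP -> //.
  rewrite hr; have -> : x j - x l = (- c1) *: (g j - g i) - (- c2) *: (g l - g i).
    transitivity ((x j - x i) - (x l - x i)).
      by apply/rowP => n; rewrite !mxE; ring.
    by rewrite h1 h2; apply/rowP => n; rewrite !mxE; ring.
  by rewrite memvZ // memvB ?memvZ.
move=> i j k l f; have [r hr] := D _ _ _ _ f; have [q hq] := D _ _ _ _ (face_rot f).
rewrite /mixed_area.
have -> : g j - g l = q *: (x i - x k) by rewrite -opprB hq -scalerN opprB.
have -> : g i - g k = - r *: (x j - x l) by rewrite scaleNr -hr opprB.
by rewrite !wedgeZr !wedge_self !scaler0 subrr scaler0.
Qed.

End Geometry.

(** * Points with real cross ratio and the linear relation of their null vectors *)

Section Circles.
Context {R : realType}.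
Local Notation C := R[i].
Implicit Types (a b c d : 'cV[C]_2).

Lemma cross_ratio_spinor a b c d (K : C) :
  br a b * br c d = K * (br b c * br d a) ->
  (br d b * br a b) *: c =
    br b c *: ((K - 1) *: (br a b *: d) - K *: (br d b *: a)).
Proof.
move=> h; apply/eqP; rewrite -subr_eq0; apply/eqP.
transitivity ((K * (br b c * br d a) - br a b * br c d) *: b); last first.
  by rewrite h subrr scale0r.
by apply: cv2P; rewrite !mxE /br; ring.
Qed.

Lemma conj_real_comb (x y : R) (p q : C) :
  (x%:C * p - y%:C * q)^*%R = x%:C * p^*%R - y%:C * q^*%R.
Proof.
transitivity ((x%:C)^*%R * p^*%R - (y%:C)^*%R * q^*%R); first by ring.
by rewrite !conjR.
Qed.

(** For real coefficients the mixed terms $ab^\dagger+ba^\dagger$ occur symmetrically and can be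
    absorbed into the square of $b-a$. This is where reality of the cross ratio enters. *)
Lemma outer_real_comb (x y : R) a b :
  outer (x%:C *: a - y%:C *: b) (x%:C *: a - y%:C *: b) =
  (x * (x - y))%:C *: outer a a + (y * (y - x))%:C *: outer b b
    + (x * y)%:C *: outer (b - a) (b - a).
Proof. by apply/matrixP => k l; rewrite !mxE conj_real_comb; ring. Qed.

(** A real cross ratio places four points of the sphere on a circle, and their null vectors in a
    three-dimensional subspace. The relation comes from writing the spinor [c] as a combination of
    [d] and [a] ([cross_ratio_spinor]) and squaring it; by the Plücker identity the difference of
    the two summands is a multiple of [b]. *)
Lemma concircular a b c d (K : R) :
  br a b * br c d = K%:C * (br b c * br d a) ->
  (nsq (br a b) * nsq (br d b)) *: nv c = nsq (br b c) *:
    ((K * nsq (br d b)) *: nv a + (K * (K - 1) * nsq (br d a)) *: nv b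
     + ((1 - K) * nsq (br a b)) *: nv d).
Proof.
move=> h; have e := cross_ratio_spinor h.
apply: herm_inj; rewrite !(hermZ, hermD) !herm_nv.
have -> : (nsq (br a b) * nsq (br d b))%:C *: outer c c =
    outer ((br d b * br a b) *: c) ((br d b * br a b) *: c).
  by rewrite outerZ nsqM mulrC.
rewrite e outerZ; congr (_ *: _).
set U := br a b *: d; set V := br d b *: a.
have -> : outer ((K%:C - 1) *: U - K%:C *: V) ((K%:C - 1) *: U - K%:C *: V) =
   (1 - K)%:C *: outer U U + K%:C *: outer V V
    + (K * (K - 1))%:C *: outer (V - U) (V - U).
  rewrite (_ : K%:C - 1 = (K - 1)%:C); last by rewrite rmorphB rmorph1.
  rewrite outer_real_comb.
  have -> : (K - 1) * (K - 1 - K) = 1 - K by ring.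
  have -> : K * (K - (K - 1)) = K by ring.
  by rewrite [(K - 1) * K]mulrC.
have -> : V - U = br d a *: b.
  by apply: cv2P; rewrite /U /V !mxE /br; ring.
rewrite !outerZ.
move: (outer a a) (outer b b) (outer d d) (nsq _) (nsq _) (nsq _) => A B D n1 n2 n3.
apply/matrixP => k l; rewrite !mxE; ring.
Qed.

(** The Gram matrix of the three null vectors has zero diagonal and nonzero off-diagonal entries, so
    it is invertible. *)
Lemma nv_free3 a b d : br a b != 0 -> br d a != 0 -> br d b != 0 ->
  free [:: nv a; nv b; nv d].
Proof.
move=> ab da db.
have n2 : (- 2^-1 : R) != 0 by rewrite oppr_eq0 invr_eq0 pnatr_eq0.
have nn (u v : 'cV[C]_2) : br u v != 0 -> mdot (nv u) (nv v) != 0.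
  by move=> h; rewrite mdot_nvnv mulf_neq0 // nsq_eq0.
have n0 (u : 'cV[C]_2) : mdot (nv u) (nv u) = 0.
  by rewrite mdot_nvnv br_self nsq_real expr0n mulr0.
have d0 : nv d != 0.
  by apply: contraNneq (nn _ _ da) => ->; rewrite mdotC mdot0r.
rewrite 2!free_cons seq1_free span_cons !span_seq1 d0 andbT; apply/andP; split.
  apply/negP => /memv_addP[_ /vlineP[p ->] [_ /vlineP[q ->] e]].
  have h1 := congr1 (mdot (nv a)) e; have h2 := congr1 (mdot (nv b)) e.
  have h3 := congr1 (mdot (nv d)) e.
  move: h1 h2 h3 (nn _ _ ab) (nn _ _ da).
  rewrite !mdotDr !mdotZr !n0 !(mdotC (nv b) (nv a)) !(mdotC (nv a) (nv d)) !(mdotC (nv b) (nv d)).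
  move: (mdot (nv a) (nv b)) (mdot (nv d) (nv a)) (mdot (nv d) (nv b)) => X Y Z.
  move=> h1 h2 h3 x0 y0.
  have : 2 * (X * Y) = 0.
    transitivity (Z * 0); last by rewrite mulr0.
    transitivity ((p * 0 + q * Z) * Y + X * (p * Z + q * 0)); last by rewrite [in RHS]h1; ring.
    by rewrite -h2 -h3; ring.
  by move/eqP; rewrite !mulf_eq0 pnatr_eq0 (negPf x0) (negPf y0).
apply/negP => /vlineP[p e]; have := nn _ _ db.
by rewrite e mdotZr n0 mulr0 eqxx.
Qed.

(** For $g_a=\gamma_a\,aa^\dagger$ and $g_b=\gamma_b\,bb^\dagger$ this is $-\tau/(2(g_a,g_b))$, the
    factor between $dx$ and $dg$ on an edge. *)
Definition kap (tau ga gb : R) (a b : 'cV[C]_2) : R := tau / (ga * gb * nsq (br a b)).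

Lemma kap_neq0 tau ga gb a b : tau != 0 -> ga != 0 -> gb != 0 -> br a b != 0 ->
  kap tau ga gb a b != 0.
Proof.
by move=> t0 a0 b0 ab; rewrite mulf_neq0 // invr_eq0 2?mulf_neq0 // nsq_eq0.
Qed.

(** By [concircular], $g_c$ is a combination of $g_a,g_b,g_d$; the last hypothesis says that its
    coefficients sum to 1. Hence $g_c-g_a$ is a combination of the edges $g_b-g_a$ and $g_d-g_a$,
    and the ratio [K] of [t1] and [t2] makes it proportional to $x_b-x_d$. *)
Lemma diagonal_dual a b c d (ga gb gc gd K t1 t2 : R) (xa xb xd : 'rV[R]_4) :
  br a b * br c d = K%:C * (br b c * br d a) -> K * t2 = t1 ->
  [/\ br a b != 0, br d a != 0 & br d b != 0] ->
  [/\ ga != 0, gb != 0, gc != 0 & gd != 0] -> t1 != 0 -> t2 != 0 ->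
  xb - xa = kap t1 ga gb a b *: (ga *: nv a - gb *: nv b) ->
  xd - xa = kap t2 ga gd a d *: (ga *: nv a - gd *: nv d) ->
  nsq (br a b) * nsq (br d b) / gc = nsq (br b c) *
    (K * nsq (br d b) / ga + K * (K - 1) * nsq (br d a) / gb
      + (1 - K) * nsq (br a b) / gd) ->
  exists s, gc *: nv c - ga *: nv a = s *: (xb - xd).
Proof.
move=> h Kt [ab da db] [ga0 gb0 gc0 gd0] t10 t20 hb hd W.
have := concircular h; move: W; rewrite -!nsq_eq0 in ab da db.
have ad : nsq (br a d) = nsq (br d a) by rewrite br_anti nsqN.
move: hb hd; rewrite /kap ad; move: (nsq (br a b)) (nsq (br d b)) (nsq (br d a)) (nsq (br b c)) ab db da => n1 n2 n3 n4 n10 n20 n30 hb hd.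
clear h ad; set A := nv a; set B := nv b; set CC := nv c; set DD := nv d => W E.
have n12 : n1 * n2 != 0 by rewrite mulf_neq0.
have -> : CC = (n4 / (n1 * n2)) *: ((K * n2) *: A + (K * (K - 1) * n3) *: B + ((1 - K) * n1) *: DD).
  by apply: (scalerI n12); rewrite scalerA mulrCA mulfV // mulr1 E.
have K0 : K != 0 by apply: contraNneq t10 => K0; rewrite -Kt K0 mul0r.
have -> : xb - xd = (xb - xa) - (xd - xa) by rewrite opprB addrA subrK.
rewrite hb hd -Kt.
pose r := gc * n4 / (n1 * n2).
(* [cB] and [cD] are the coefficients of $g_b$ and $g_d$ in $g_c$; [s] is then forced by comparing
   the terms in $g_b$, and those in $g_d$ agree. *)
pose cB := r * (K * (K - 1) * n3) / gb; pose cD := r * ((1 - K) * n1) / gd.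
pose s := - (r * (K - 1) * n3 * ga * n1 / t2); exists s.
have sB : s * (K * t2 / (ga * gb * n1)) = - cB.
  by rewrite /s /cB; field; nz.
have sD : s * (t2 / (ga * gd * n3)) = cD.
  by rewrite /s /cD; field; nz.
rewrite scalerBr !scalerA sB sD.
(* The hypothesis [W] is used here: the coefficient of $g_a$ in $g_c$ is $1-c_B-c_D$. *)
have cA : r * (K * n2) = ga - cB * ga - cD * ga.
  rewrite /cB /cD /r; have := congr1 (fun q => q * ga * gc / (n1 * n2)) W.
  rewrite [X in X = _ -> _](_ : _ = ga); last by field; nz.
  by move=> {1}->; field; nz.
have eB : r * (K * (K - 1) * n3) = cB * gb by rewrite /cB mulfVK.
have eD : r * ((1 - K) * n1) = cD * gd by rewrite /cD mulfVK.
rewrite mulrA -/r !scalerDr !scalerA cA eB eD.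
by apply/rowP => k; rewrite !mxE; ring.
Qed.
End Circles.

(** * Square roots of real numbers and the change of a Hermitian matrix along an edge *)

Section EdgeTransport.
Context {R : realType}.
Local Notation C := R[i].
Implicit Types (a b : 'cV[C]_2).

(** The root is real or imaginary according to the sign of [r]. All the signs [eps] originate
    here. *)
Lemma conj_sqrt_real (z : C) (r : R) : z ^+ 2 = r%:C -> z^*%R = (Num.sg r)%:C * z.
Proof.
case: z => a b /eqP; rewrite expr2 eq_complex /= => /andP[/eqP h1 /eqP h2].
have E : (a +i* b)^*%R = a -i* b by [].
have := h2; rewrite [b * a]mulrC => /eqP; rewrite -mulr2n mulrn_eq0 /= mulf_eq0.
case/orP => /eqP e; rewrite E; apply/eqP; rewrite eq_complex /= -h1 e !mul0r !mulr0 ?sub0r ?subr0 ?add0r ?addr0.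
- have [->|b0] := eqVneq b 0; first by rewrite !mulr0 oppr0 eqxx.
  have bb : 0 < b * b by rewrite -expr2 exprn_even_gt0.
  by rewrite sgrN gtr0_sg // oppr0 mulN1r !eqxx.
- have [->|a0] := eqVneq a 0; first by rewrite !mulr0 oppr0 eqxx.
  have aa : 0 < a * a by rewrite -expr2 exprn_even_gt0.
  by rewrite gtr0_sg // mul1r oppr0 !eqxx.
Qed.

Lemma nsq_sqrt_real (z : C) (r : R) : z ^+ 2 = r%:C -> nsq z = Num.sg r * r.
Proof.
move=> h; apply: complexI; rewrite nsqE (conj_sqrt_real h) mulrCA -expr2 h.
by rewrite rmorphM.
Qed.

(** The squares of [a] and [b] vanish on the mixed pair, and each of them vanishes on its own
    spinor. A difference of Hermitian forms that vanishes on the mixed pair is therefore a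
    combination of the two, with coefficients read off from the diagonal values. *)
Lemma herm_edge a b (ga gb tau : R) (xa xb : 'rV[R]_4) : br a b != 0 ->
  ga != 0 -> gb != 0 ->
  hq (herm xb) a a = hq (herm xa) a a - (tau / ga)%:C ->
  hq (herm xb) b b = hq (herm xa) b b + (tau / gb)%:C ->
  hq (herm xb) a b = hq (herm xa) a b ->
  xb - xa = kap tau ga gb a b *: (ga *: nv a - gb *: nv b).
Proof.
move=> ab ga0 gb0 haa hbb hab; apply: herm_inj.
have conjhq x u v : hq (herm x) v u = (hq (herm x) u v)^*%R.
  have D m n : herm x m n = (herm x n m)^*%R by rewrite -daggerE dagger_herm.
  rewrite /hq !rmorphD !rmorphN /= !rmorphM /= !conjCK -!D; ring.
have n0 : nsq (br a b) != 0 by rewrite nsq_eq0.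
have ba : nsq (br b a) = nsq (br a b) by rewrite br_anti nsqN.
have sr : br a a = 0 /\ br b b = 0 by rewrite !br_self.
rewrite hermB hermZ hermB !hermZ !herm_nv.
have [aa bb] := sr.
apply: (hq_inj ab); rewrite !(hqD, hqN, hqZ, hq_outer) ?aa ?bb ?conjC0 ?mulr0 ?mul0r ?mulr0.
- rewrite haa -nsqE; transitivity (- (tau / ga)%:C); first by ring.
  have -> : tau / ga = kap tau ga gb a b * (gb * nsq (br a b)) by rewrite /kap; field; nz.
  ring.
- rewrite hab; ring.
- rewrite conjhq hab -conjhq; ring.
- rewrite hbb -nsqE ba; transitivity ((tau / gb)%:C); first by ring.
  have -> : tau / gb = kap tau ga gb a b * (ga * nsq (br a b)) by rewrite /kap; field; nz.
  ring.
Qed.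
End EdgeTransport.

(** * From a discrete holomorphic function to the surface *)

Section Representation.
Context {R : realType} (mu : R) (psi : vertex -> R[i])
  (me : vertex -> vertex -> R) (m : R) (Psi : vertex -> 'M[R[i]]_2)
  (eps : vertex -> R) (x : surface R) (G : gauss_map R).
Context (frame : weierstrass_frame predT psi me m Psi).
Context (signs : frame_sign predT me m eps).
Context (repr : weierstrass_representation predT mu psi Psi eps x G).
Context (nonorth : nowhere_orthogonal x G).
Local Notation C := R[i].

Let u i : 'cV[C]_2 := sp (psi i) 1.
Let w i : 'cV[C]_2 := Psi i *m u i.
(** The form of diag$(1,-\mu)$ at $(\psi_i,1)$. It is nonzero exactly when $x_i\not\perp G_i$, and
    dividing by it normalises the section [gh] to $(g_i,x_i)=-\frac12$. *)
Let rho i : R := 1 - mu * nsq (psi i).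
Let ga i : R := eps i / rho i.
Let gh : surface R := fun i => ga i *: nv (w i).
Let lam i j : R := (me i j + m) / me i j.

Lemma rep_det i : \det (Psi i) = 1.
Proof. by case: frame => _ _ _ h _; apply: h. Qed.
Lemma rep_eps i : eps i ^+ 2 = 1.
Proof. by case: signs => /(_ i isT)[] -> _; rewrite ?sqrrN expr1n. Qed.
Lemma rep_eps_neq0 i : eps i != 0.
Proof.
apply/eqP => h; have := rep_eps i; rewrite h expr0n /= => /eqP.
by rewrite eq_sym oner_eq0.
Qed.
Lemma rep_me i j : edge predT i j -> me i j != 0.
Proof. by case: frame => [[h _] _ _ _ _] /h[]. Qed.
Lemma rep_mem i j : edge predT i j -> me i j + m != 0.
Proof. by case: frame => [_ _ h _ _]; apply: h. Qed.
Lemma rep_m : m != 0. Proof. by case: frame. Qed.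

Lemma rep_hq i (a b : 'cV[C]_2) : hq (herm (x i)) (Psi i *m a) (Psi i *m b) =
  (eps i)%:C * hq (mx2 1 0 0 (- mu%:C)) a b.
Proof. by have [-> _] := @repr i isT; rewrite hqZ hqM rep_det conjC1 !mul1r. Qed.

Lemma hqD_u i : hq (mx2 1 0 0 (- mu%:C)) (u i) (u i) = (rho i)%:C.
Proof.
rewrite /hq /u !sp0 !sp1 !mxE /= /rho rmorphB rmorphM /= nsqE conjC1 rmorph1.
ring.
Qed.

Lemma u_neq0 i : u i != 0.
Proof. by apply/eqP => /matrixP/(_ 1 0)/eqP; rewrite sp1 mxE oner_eq0. Qed.

Lemma Psi_neq0 i (a : 'cV[C]_2) : a != 0 -> Psi i *m a != 0.
Proof.
apply: contraNneq => h; have U : Psi i \in unitmx by rewrite unitmxE rep_det unitr1.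
by rewrite -(mulKmx U a) h mulmx0.
Qed.

Lemma mdot_x_nv i : mdot (x i) (nv (w i)) = - 2^-1 * (eps i * rho i).
Proof.
apply: complexI; rewrite mdot_nv rep_hq hqD_u !rmorphM rmorphN /=.
by rewrite fmorphV rmorph_nat.
Qed.

Lemma gauss_line i : G i = <[nv (w i)]>%VS.
Proof.
have [_ [v hv ->]] := @repr i isT.
have w0 : w i 0 0 = Psi i 0 0 * psi i + Psi i 0 1 by rewrite mul2E !mxE mulr1.
have w1 : w i 1 0 = Psi i 1 0 * psi i + Psi i 1 1 by rewrite mul2E !mxE mulr1.
have wn : w i != 0 := Psi_neq0 i (u_neq0 i).
suff [c c0 ->] : exists2 c, c != 0 & nv (w i) = c *: v.
  apply/eqP; rewrite eqEsubv -!memvE memvZ ?memv_line // andbT.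
  by apply/vlineP; exists c^-1; rewrite scalerA mulVf // scale1r.
move: hv; rewrite /gauss_mx -w0 -w1 {w0 w1}; move: (w i) wn => a an.
have [q0|q0] := eqVneq (a 1 0) 0 => hv.
  exists (nsq (a 0 0)).
    rewrite nsq_eq0; apply: contraNneq an => p0.
    by apply/eqP/cv2P; rewrite [RHS]mxE.
  apply: herm_inj; rewrite hermZ hv herm_nv.
  by apply: mx2P; rewrite !mxE /= ?q0 ?conjC0 ?mulr0 ?mul0r // mulr1 nsqE.
exists (nsq (a 1 0)); first by rewrite nsq_eq0.
apply: herm_inj; rewrite hermZ hv herm_nv.
apply: mx2P; rewrite !mxE /= ?normCK nsqE; field; repeat (apply/andP; split); by rewrite ?fmorph_eq0.
Qed.

Lemma rho_neq0 i : rho i != 0.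
Proof.
apply/eqP => r0; apply: (@nonorth i) => v; rewrite gauss_line => /vlineP[c ->].
by rewrite mdotZr mdot_x_nv r0 !mulr0.
Qed.

Lemma ga_neq0 i : ga i != 0.
Proof. by rewrite mulf_neq0 ?invr_eq0 ?rho_neq0 ?rep_eps_neq0. Qed.

Lemma w_neq0 i : w i != 0. Proof. exact: Psi_neq0 (u_neq0 i). Qed.

Lemma section_gh : section_G G gh.
Proof.
move=> i; split; first by rewrite scaler_eq0 (negPf (ga_neq0 i)) nv_eq0 w_neq0.
rewrite gauss_line; apply/eqP; rewrite eqEsubv -!memvE memvZ ?memv_line //=.
by apply/vlineP; exists (ga i)^-1; rewrite scalerA mulVf ?ga_neq0 // scale1r.
Qed.

Lemma mdot_gh i : mdot (gh i) (gh i) = 0.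
Proof. by rewrite mdotZl mdotZr mdot_nvnv br_self nsq_real expr0n /= !mulr0. Qed.

Lemma mdot_gh_x i : mdot (gh i) (x i) = - 2^-1.
Proof.
rewrite mdotC mdotZr mdot_x_nv /ga; have := rep_eps i; have := rho_neq0 i.
move: (rho i) (eps i) => r e r0 e1; rewrite mulrCA; have -> : e / r * (e * r) = e ^+ 2 by field.
by rewrite e1 mulr1.
Qed.

Lemma mdot_xx i : mdot (x i) (x i) = mu.
Proof.
apply: complexI; have := det_herm (x i); have [-> _] := @repr i isT.
rewrite detZ !det_mulmx rep_det mul1r rmorphN /= => /eqP; rewrite -eqr_oppLR => /eqP <-.
have -> : \det (dagger (Psi i)) = (\det (Psi i))^*%R.
  by rewrite !det2E !daggerE; ring.
rewrite rep_det conjC1 mulr1 -rmorphXn /= rep_eps mul1r det2E !mxE /=; ring.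
Qed.

Section Edges.
Context (s t : vertex -> vertex -> C).
Context (hs : edge_sqrt predT me s).
Context (ht : edge_sqrt predT (fun i j => me i j + m) t).
Context (hB : forall i j, edge predT i j -> Psi j = Psi i *m Bmx psi me m s t i j).
Let z i j : C := s i j / t i j.

Lemma s_neq0 i j : edge predT i j -> s i j != 0.
Proof.
move=> e; have [h _] := hs; have [h2 _] := h i j e.
apply/eqP => s0; have := rep_me e.
by rewrite -(fmorph_eq0 (real_complex R)) /= -h2 s0 expr0n eqxx.
Qed.
Lemma t_neq0 i j : edge predT i j -> t i j != 0.
Proof.
move=> e; have [h _] := ht; have [h2 _] := h i j e.
apply/eqP => s0; have := rep_mem e.
by rewrite -(fmorph_eq0 (real_complex R)) /= -h2 s0 expr0n eqxx.
Qed.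
Lemma z_neq0 i j : edge predT i j -> z i j != 0.
Proof. by move=> e; rewrite mulf_neq0 ?invr_eq0 ?s_neq0 ?t_neq0. Qed.
Lemma z_sym i j : edge predT i j -> z i j = z j i.
Proof. by move=> e; have [/(_ i j e)[_ h] _] := hs; have [/(_ i j e)[_ h'] _] := ht; rewrite /z h h'. Qed.
Lemma z_sqr i j : edge predT i j -> z i j ^+ 2 = ((lam i j)^-1)%:C.
Proof.
move=> e; have [/(_ i j e)[h _] _] := hs; have [/(_ i j e)[h' _] _] := ht.
by rewrite /z expr_div_n h h' /lam invf_div fmorph_div.
Qed.
Lemma lam_neq0 i j : edge predT i j -> lam i j != 0.
Proof. by move=> e; rewrite mulf_neq0 ?invr_eq0 ?rep_me ?rep_mem. Qed.
Lemma sg_lam i j : edge predT i j -> eps j = eps i * Num.sg (lam i j)^-1.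
Proof.
by move=> e; case: signs => _ /(_ i j e) ->; rewrite /lam invf_div !sgrM sgrV.
Qed.
Lemma sg_lam' i j : edge predT i j -> eps i = eps j * Num.sg (lam i j)^-1.
Proof.
move=> e; rewrite (sg_lam e) -mulrA -sgrM -expr2 gtr0_sg ?mulr1 //.
by rewrite exprn_even_gt0 //= invr_eq0 lam_neq0.
Qed.
Lemma nsq_z i j : edge predT i j -> nsq (z i j) = Num.sg (lam i j)^-1 / lam i j.
Proof. by move/z_sqr/nsq_sqrt_real. Qed.

Lemma psi_neq i j : edge predT i j -> psi i - psi j != 0.
Proof.
move=> e; have [k [l f]] := edge_face e.
case: frame => [[h1 h2] _ _ _ _].
have [e1 e2 h _] := h2 _ _ _ _ f; apply/eqP => d0; move: h; rewrite d0 !mul0r.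
have [[eij _ _ eli _] eil] := face_edges f.
by move/esym/eqP; rewrite fmorph_eq0 mulf_eq0 invr_eq0 (negPf (rep_me eij)) (negPf (rep_me eil)).
Qed.

(** $(\psi_j,1)$ is an eigenvector of $B_{ij}$ with eigenvalue $z_{ij}$. Hence $w_j$, defined by the
    frame at [j], can also be computed with the frame at [i]. *)
Lemma Psi_u i j : edge predT i j -> w j = z i j *: (Psi i *m u j).
Proof.
move=> e; rewrite /w (hB e) -mulmxA scalemxAr; congr (_ *m _).
have := psi_neq e; have := s_neq0 e; have := t_neq0 e.
have [/(_ i j e)[h _] _] := hs; move=> t0 s0 d0.
apply: cv2P; rewrite !(mul2E, mxE) /= /z -h; field; nz.
Qed.

Lemma br_w i j : edge predT i j -> br (w i) (w j) = z i j * (psi i - psi j).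
Proof.
move=> e; rewrite (Psi_u e) brZr brM rep_det mul1r /br !sp0 !sp1; ring.
Qed.

(** Both spinors can be expressed in either frame, so the forms of $x_i$ and $x_j$ are compared on
    $w_i,w_j$: the mixed values agree, and the diagonal ones are scaled by $1/\lambda$ and
    $\lambda$. The result is then an instance of [herm_edge]. *)
Lemma edge_formula i j : edge predT i j ->
  x j - x i = kap (1 - (lam i j)^-1) (ga i) (ga j) (w i) (w j) *: (gh i - gh j).
Proof.
move=> e; have e' : edge predT j i by rewrite edge_sym.
have hj := Psi_u e; have hi := Psi_u e'; rewrite -(z_sym e) in hi.
have ei := rep_eps i; have ej := rep_eps j.
have sg2 := sg_lam e; have nz2 := nsq_z e; have cz := conj_sqrt_real (z_sqr e).
have ri := rho_neq0 i; have rj := rho_neq0 j.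
have gi := rep_eps_neq0 i; have gj := rep_eps_neq0 j.
have gaV k : (ga k)^-1 = eps k * rho k.
  rewrite /ga invf_div mulrC; congr (_ * _); apply: (mulfI (rep_eps_neq0 k)).
  by rewrite mulfV ?rep_eps_neq0 // -expr2 rep_eps.
(* Only $|z|^2=1/|\lambda|$ is available, and the sign rule for [eps] supplies the missing sign of
   $\lambda$. *)
have EE : eps j * nsq (z i j) = eps i * (lam i j)^-1.
  rewrite nz2 mulrA -[Num.sg _](_ : eps i * eps j = _).
    by rewrite mulrCA -expr2 ej mulr1.
  by rewrite sg2 mulrA -expr2 ei mul1r.
apply: herm_edge; rewrite ?ga_neq0 ?gaV //.
- by rewrite br_w // mulf_neq0 ?z_neq0 ?psi_neq.
- rewrite {1 2}hi hqZl hqZr !rep_hq !hqD_u mulrCA.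
  have -> : (z i j)^*%R * ((z i j) * ((eps j)%:C * (rho i)%:C)) = (eps j * nsq (z i j))%:C * (rho i)%:C.
    by rewrite [in RHS](rmorphM (real_complex R)) /= nsqE; ring.
  by rewrite EE -!rmorphM -rmorphB; congr (_%:C); ring.
- rewrite rep_hq hqD_u hj hqZl hqZr rep_hq hqD_u.
  have -> : (z i j) * ((z i j)^*%R * ((eps i)%:C * (rho j)%:C)) = (eps i * nsq (z i j))%:C * (rho j)%:C.
    by rewrite [in RHS](rmorphM (real_complex R)) /= nsqE; ring.
  have -> : eps i * nsq (z i j) = eps j * (lam i j)^-1.
    by rewrite nz2 mulrA -sg2.
  by rewrite -!rmorphM -rmorphD; congr (_%:C); ring.
- rewrite {1}hi hqZl rep_hq hj hqZr rep_hq cz sg2 rmorphM /=; ring.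
Qed.

Lemma lam_face i j k l : face predT i j k l ->
  [/\ lam i j = lam l k, lam i l = lam j k, z i j = z l k & z i l = z j k].
Proof.
move=> f; case: frame => [[h1 h2] _ _ _ _]; have [e1 e2 _ _] := h2 _ _ _ _ f.
have [_ /(_ _ _ _ _ f)[a1 a2]] := hs; have [_ /(_ _ _ _ _ f)[b1 b2]] := ht.
by rewrite /lam /z e1 e2 a1 a2 b1 b2.
Qed.

Lemma face_cross i j k l : face predT i j k l ->
  (psi i - psi j) * (psi k - psi l) =
    (me i l / me i j)%:C * ((psi j - psi k) * (psi l - psi i)) /\ me i l / me i j < 0.
Proof.
move=> f; case: frame => [[_ h2] _ _ _ _]; have [_ _ <- ?] := h2 _ _ _ _ f.
have [[eij ejk ekl eli _] _] := face_edges f; split=> //.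
have d1 := psi_neq ejk; have d2 := psi_neq eli; field; nz.
Qed.

(** If $\psi_j=\psi_l$ the cross ratio would be 1, but it is negative. *)
Lemma psi_diag i j k l : face predT i j k l -> psi j - psi l != 0.
Proof.
move=> f; have [h neg] := face_cross f.
have [[eij ejk ekl eli _] _] := face_edges f.
apply/eqP => d0; have e : psi j = psi l by apply/eqP; rewrite -subr_eq0 d0.
have d1 := psi_neq ejk; have d2 := psi_neq eli.
have : (me i l / me i j)%:C = 1 :> C.
  apply: (mulIf (mulf_neq0 d1 d2)); rewrite -h e; ring.
by move=> [h1]; move: neg; rewrite h1 ltr10.
Qed.

Lemma br_diag i j k l : face predT i j k l ->
  br (w l) (w j) = z i j * z i l * (psi l - psi j) /\ br (w l) (w j) != 0.
Proof.
move=> f; have [[eij _ _ _ _] eil] := face_edges f.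
have E : br (w l) (w j) = z i j * z i l * (psi l - psi j).
  rewrite (Psi_u eij) (Psi_u eil) brZl brZr brM rep_det mul1r /br !sp0 !sp1; ring.
have d0 := psi_diag f; rewrite -oppr_eq0 opprB in d0.
by split=> //; rewrite E; apply: (mulf_neq0 (mulf_neq0 (z_neq0 eij) (z_neq0 eil))).
Qed.

(** The functional [L] takes the value $\rho$ on the null vector of $(\psi,1)$, so applying it to
    the relation of [concircular] replaces each null vector by its $\rho$. *)
Lemma rho_face i j k l (K : R) : 
  (psi i - psi j) * (psi k - psi l) = K%:C * ((psi j - psi k) * (psi l - psi i)) ->
  nsq (psi i - psi j) * nsq (psi l - psi j) * rho k = nsq (psi j - psi k) *
    (K * nsq (psi l - psi j) * rho i + K * (K - 1) * nsq (psi l - psi i) * rho j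
      + (1 - K) * nsq (psi i - psi j) * rho l).
Proof.
have bru a b : br (u a) (u b) = psi a - psi b by rewrite /br !sp0 !sp1; ring.
pose L (M : 'M[C]_2) := M 1 1 - mu%:C * M 0 0.
have hN a : L (herm (nv (u a))) = (rho a)%:C.
  rewrite /L herm_nv !mxE /= -(nsqE (psi a)) conjC1 mulr1 /rho; ring.
have LD M N : L (M + N) = L M + L N by rewrite /L !mxE; ring.
have LZ (c : C) M : L (c *: M) = c * L M by rewrite /L !mxE; ring.
rewrite -!bru => /concircular/(congr1 (fun v => L (herm v))).
rewrite !(hermZ, hermD) !(LZ, LD) !hN -!rmorphM -!rmorphD -!rmorphM /=.
by move/complexI.
Qed.

Lemma face_dual i j k l : face predT i j k l ->
  exists r, gh k - gh i = r *: (x j - x l).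
Proof.
move=> f; have [[eij ejk ekl eli elk] eil] := face_edges f.
have [l1 l2 z1 z2] := lam_face f; have [cr _] := face_cross f.
have [dE d0] := br_diag f; have elj : edge predT j k by [].
have m1 := rep_me eij; have m2 := rep_me eil.
have n1 := rep_mem eij; have n2 := rep_mem eil.
(* The cross ratio of the spinors [w]. It differs from that of $\psi$ by $z_{ij}^2/z_{il}^2$, and it
   equals $\tau_{ij}/\tau_{il}$ because $\tau=m/(m_{ij}+m)$. *)
pose K := (me i l + m) / (me i j + m).
have g0 := ga_neq0.
have W := rho_face cr.
have nz1 := nsq_z eij; have nz2 := nsq_z eil.
have s1 := sg_lam' eij; have s2 := sg_lam' ejk; have s3 := sg_lam' elk.
have s4 := sg_lam' eil.
rewrite -l2 in s2; rewrite -l1 in s3.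
have gaV a : (ga a)^-1 = eps a * rho a.
  rewrite /ga invf_div mulrC; congr (_ * _); apply: (mulfI (rep_eps_neq0 a)).
  by rewrite mulfV ?rep_eps_neq0 // -expr2 rep_eps.
have bij := br_w eij; have bjk := br_w ejk; have bil := br_w eil.
have bli : br (w l) (w i) = z i l * (psi l - psi i).
  by rewrite br_anti bil -mulrN opprB.
have bkl : br (w k) (w l) = z i j * (psi k - psi l).
  by rewrite (br_anti (w k)) (br_w elk) -z1 -mulrN opprB.
rewrite -z2 in bjk.
have zz1 := z_sqr eij; have zz2 := z_sqr eil.
apply: (@diagonal_dual R (w i) (w j) (w k) (w l) (ga i) (ga j) (ga k) (ga l) K
  (1 - (lam i j)^-1) (1 - (lam i l)^-1)) => //.
- rewrite bij bkl bjk bli.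
  have -> : z i j * (psi i - psi j) * (z i j * (psi k - psi l)) =
     z i j ^+ 2 * ((psi i - psi j) * (psi k - psi l)) by ring.
  have -> : z i l * (psi j - psi k) * (z i l * (psi l - psi i)) =
     z i l ^+ 2 * ((psi j - psi k) * (psi l - psi i)) by ring.
  rewrite zz1 zz2 cr !mulrA -!rmorphM; congr (_%:C * _ * _).
  by rewrite /K /lam !invf_div; field; nz.
- by rewrite /K /lam !invf_div; field; nz.
- split; last exact: d0.
  + by rewrite bij mulf_neq0 ?z_neq0 ?psi_neq.
  + by rewrite bli mulf_neq0 ?z_neq0 // -oppr_eq0 opprB psi_neq.
- by rewrite /lam invf_div (_ : 1 - _ = m / (me i j + m)) ?mulf_neq0 ?invr_eq0 ?rep_m //; field.
- by rewrite /lam invf_div (_ : 1 - _ = m / (me i l + m)) ?mulf_neq0 ?invr_eq0 ?rep_m //; field.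
- exact: edge_formula.
- exact: edge_formula.
rewrite bij dE bjk bli !gaV; move: nz1 nz2.
move: (z i j) (z i l) => z3 z4 nz1 nz2; rewrite !nsqM nz1 nz2.
(* Each of the four signs is [eps k] times a product of the signs [S1], [S2] of the two edge
   directions. Inserting $S_1^2=S_2^2=1$ reduces the claim to [rho_face]. *)
have sq a : a != 0 -> Num.sg a ^+ 2 = 1 :> R by move=> a0; rewrite sqr_sg a0.
have := sq _ (mulf_neq0 m1 (invr_neq0 n1)); have := sq _ (mulf_neq0 m2 (invr_neq0 n2)).
move: s1; rewrite s2 s3 /K /lam !invf_div => ->.
move: (Num.sg (me i j / _)) (Num.sg (me i l / _)) => S1 S2 h2 h1.
move: W m1 m2 n1 n2; move: (me i j) (me i l) (nsq (psi i - psi j)) (nsq (psi l - psi j))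
  (nsq (psi j - psi k)) (nsq (psi l - psi i)) => a b N1 N2 N3 N4 W m1 m2 n1 n2.
move: (eps k) (rho i) (rho j) (rho k) (rho l) W => e ri rj rk rl W.
transitivity (S1 ^+ 2 * S2 * e * (a / (a + m)) ^+ 2 * (b / (b + m)) * (N1 * N2 * rk)).
  by ring.
rewrite W; transitivity (S2 * e * (a / (a + m)) ^+ 2 * (b / (b + m)) * (N3 *
   (b / a * N2 * ri + b / a * (b / a - 1) * N4 * rj + (1 - b / a) * N1 * rl))).
  by rewrite h1; ring.
transitivity (S2 * e * (b / (b + m)) * N3 *
 (S1 ^+ 2 * S2 ^+ 2 * ((b + m) / (a + m) * (a / (a + m) * (b / (b + m))) * N2 * ri)
  + S2 ^+ 2 * ((b + m) / (a + m) * ((b + m) / (a + m) - 1) * (b / (b + m)) * N4 * rj)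
  + S1 ^+ 2 * ((1 - (b + m) / (a + m)) * (a / (a + m)) * N1 * rl))).
  by rewrite h1 h2; field; nz.
by ring.
Qed.
Lemma br_edge i j : edge predT i j -> br (w i) (w j) != 0.
Proof. by move=> e; rewrite br_w // mulf_neq0 ?z_neq0 ?psi_neq. Qed.

Lemma edge_step i j : edge predT i j -> exists2 c, c != 0 & x j - x i = c *: (gh i - gh j).
Proof.
move=> e; eexists; last exact: edge_formula.
have n1 := rep_mem e; have m1 := rep_me e.
have h : 1 - (lam i j)^-1 = m / (me i j + m) by rewrite /lam invf_div; field.
rewrite h; apply: kap_neq0; rewrite ?ga_neq0 ?mulf_neq0 ?invr_eq0 ?rep_m //.
exact: br_edge.
Qed.

Lemma rep_legendre : legendre x G.
Proof.
split=> [i|i j e|i j k l f].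
- rewrite gauss_line; split; first by rewrite dim_vline nv_eq0 w_neq0.
  by move=> v /vlineP[c ->]; rewrite mdotZl mdotZr mdot_nvnv br_self nsq_real expr0n /= !mulr0.
(* By the edge formula $x_i+cg_i=x_j+cg_j$, and this is the common point of the two lines. *)
- have [c c0 h] := edge_step e; exists (x i + c *: gh i); rewrite /on_line.
  have hG a : gh a \in G a by have [_ <-] := section_gh a; rewrite memv_line.
  split; first by rewrite addrAC subrr add0r memvZ.
  have -> : x i + c *: gh i - x j = c *: gh j.
    apply/eqP; rewrite -subr_eq0; apply/eqP; transitivity (c *: (gh i - gh j) - (x j - x i)).
      by rewrite scalerBr; apply/rowP => n; rewrite !mxE; ring.
    by rewrite h subrr.
  by rewrite memvZ.
have [[eij _ _ eli _] eil] := face_edges f.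
have [_ lj] := br_diag f; have ij := br_edge eij; have li := br_edge eli.
have fr := nv_free3 ij li lj.
have d3 : \dim <<[:: nv (w i); nv (w j); nv (w l)]>> = 3%N by move: fr; rewrite /free => /eqP.
rewrite -[X in (X <= _)%N]d3.
apply/dimvS/span_subvP => v; rewrite !inE => /or3P[] /eqP ->.
- by rewrite -!addvA; apply: (subvP (addvSl _ _)); rewrite gauss_line memv_line.
- apply: (subvP (addvSl _ _)); apply: (subvP (addvSl _ _)); apply: (subvP (addvSr _ _)).
  by rewrite gauss_line memv_line.
- by apply: (subvP (addvSr _ _)); rewrite gauss_line memv_line.
Qed.

Lemma gh_diag i j k l : face predT i j k l -> gh j != gh l.
Proof.
move=> f; have [_ lj] := br_diag f; apply/eqP => e.
have : mdot (gh l) (gh j) = 0 by rewrite -e mdot_gh.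
have n2 : (- 2^-1 : R) != 0 by rewrite oppr_eq0 invr_eq0 pnatr_eq0.
rewrite -nsq_eq0 in lj; rewrite mdotZl mdotZr mdot_nvnv; apply/eqP.
exact: (mulf_neq0 (ga_neq0 _) (mulf_neq0 (ga_neq0 _) (mulf_neq0 n2 lj))).
Qed.
End Edges.

(** All conclusions about the constructed surface are read off from this duality. *)
Lemma rep_dual : legendre x G /\ christoffel_dual x gh.
Proof.
case: (frame) => _ _ _ _ [s [t [hs ht hB]]]; split; first exact: (rep_legendre hs ht hB).
apply: (@quadric_christoffel_dual _ x gh mu 0) => [i|i|i j e|i j k l f|i j k l f].
- exact: mdot_xx.
- exact: mdot_gh.
- exact: (edge_step hs ht hB e).
- exact: (face_dual hs ht hB f).
- exact: (gh_diag hs ht hB f).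
Qed.

Lemma rep_omega_dual : omega_dual x G.
Proof.
have [hL hd] := rep_dual; split=> //; exists x, gh; split; last exact: hd.
- by move=> i; rewrite /on_line subrr mem0v.
- exact: section_gh.
Qed.

Lemma rep_setting : curvature_setting mu x G.
Proof. by have [hL [_ hx _ _]] := rep_dual; split; last exact: mdot_xx. Qed.

Lemma rep_flat : mu = 0 -> intrinsically_flat x G.
Proof.
move=> m0; have [_ [hE _ _ hA]] := rep_dual; split; first by rewrite -m0; apply: rep_setting.
by exists gh; split; first exact: section_gh.
Qed.

Lemma rep_cmc : mu != 0 -> constant_mean_curvature mu x G (Num.sqrt `|mu|)^-1.
Proof.
move=> mu0; have [_ [hE _ _ hA]] := rep_dual; split; first exact: rep_setting.
have hs := section_gh; have hm := mdot_gh_x.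
move: (gh) hE hA hs hm => y hE hA hs hm.
have c0 : - 2 * mu != 0 by rewrite mulf_neq0 // oppr_eq0 pnatr_eq0.
(* The factor $-2\mu$ turns the normalisation $(g,x)=-\frac12$ into $(g,x)=\mu$. *)
exists (fun i => (- 2 * mu) *: y i) => n; split.
- move=> i; have [y0 <-] := hs i; split; first by rewrite scaler_eq0 negb_or c0.
  apply/eqP; rewrite eqEsubv -!memvE memvZ ?memv_line //=.
  by apply/vlineP; exists (- 2 * mu)^-1; rewrite scalerA mulVf // scale1r.
- by move=> i; rewrite mdotZl hm; field.
- move=> i j e; have [/eqP d0|d0] := boolP (x i - x j == 0).
    rewrite d0; apply: (@dim_span_le _ _ _ [:: n i - n j]) => v.
    by rewrite !inE => /orP[] /eqP ->; rewrite ?mem0v // memv_span ?mem_head.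
  have [c hc] := dim_span2_le1P d0 (hE i j e).
  apply: (@dim_span2_le1 _ _ _ ((Num.sqrt `|mu|)^-1 * (- 2 * mu * c - 1))).
  rewrite /n -scalerBr -[RHS]scalerA; congr (_ *: _).
  rewrite scalerBl scale1r -[_ *: (x i - x j)]scalerA -hc.
  by apply/rowP => a; rewrite !mxE; ring.
(* With $\sqrt{|\mu|}\,n=g-x$ and $A(x,g)=0$ one gets $A(x,n)=-A(x,x)/\sqrt{|\mu|}$. *)
move=> i j k l f; have := hA _ _ _ _ f; rewrite /mixed_area => /eqP.
rewrite scaler_eq0 invr_eq0 pnatr_eq0 subr_eq0 /= => /eqP h.
have P a b : n a - n b = (Num.sqrt `|mu|)^-1 *: ((- 2 * mu) *: (y a - y b) - (x a - x b)).
  by apply/rowP => v; rewrite !mxE; ring.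
rewrite !P; move: h; move: (x i - x k) (x j - x l) (y i - y k) (y j - y l) => a1 a2 b1 b2 h.
rewrite !wedgeZr !wedgeBr !wedgeZr h.
by apply/matrixP => a b; rewrite !mxE; ring.
Qed.
End Representation.

(** * Edge matrices with prescribed eigenlines and their flatness on faces *)

Section Transport.
Context {R : realType}.
Local Notation C := R[i].
Implicit Types (a b c d v : 'cV[C]_2).

Definition proj a b : 'M[C]_2 := (br b a)^-1 *: \matrix_(k, l)
  (a k 0 * (if l == 0 then - b 1 0 else b 0 0)).
(** Here [proj b a] projects onto the line of [b] along [a], so if $z^2=1-t$ the eigenvalues on [a]
    and [b] are $1/z$ and $z$. This is $B_{ij}$ conjugated by $\Psi_i$, expressed without reference
    to a frame. *)
Definition transport a b (z t : C) : 'M[C]_2 := z^-1 *: (1%:M - t *: proj b a).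

Lemma projE a b v : proj a b *m v = (br b v / br b a) *: a.
Proof. by apply: cv2P; rewrite !(mul2E, mxE) /= /br; ring. Qed.

Lemma transportE a b z t v :
  transport a b z t *m v = z^-1 *: (v - (t * (br a v / br a b)) *: b).
Proof. by rewrite -scalemxAl mulmxBl mul1mx -scalemxAl projE scalerA. Qed.

Lemma mx_eq_basis (M N : 'M[C]_2) a b : br a b != 0 ->
  M *m a = N *m a -> M *m b = N *m b -> M = N.
Proof.
move=> ab ha hb.
have E v : M *m v = N *m v.
  by rewrite (br_span v ab) !mulmxDr -!scalemxAr ha hb.
have E0 (L : 'M[C]_2) k : L k 0 = (L *m sp 1 0) k 0 by rewrite mul2E !mxE mulr1 mulr0 addr0.
have E1 (L : 'M[C]_2) k : L k 1 = (L *m sp 0 1) k 0 by rewrite mul2E !mxE mulr1 mulr0 add0r.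
by apply: mx2P; rewrite ?(E0 M) ?(E1 M) E -?E0 -?E1.
Qed.

Section Eigen.
Context (a b : 'cV[C]_2) (z t : C).
Context (ab : br a b != 0) (z0 : z != 0) (zt : z ^+ 2 = 1 - t).

Lemma transport_fst : transport a b z t *m a = z^-1 *: a.
Proof. by rewrite transportE br_self mul0r mulr0 scale0r subr0. Qed.

Lemma transport_snd : transport a b z t *m b = z *: b.
Proof.
rewrite transportE divff // mulr1 -[X in X - _]scale1r -scalerBl -zt scalerA.
by congr (_ *: _); field.
Qed.

Lemma transport_det : \det (transport a b z t) = 1.
Proof.
apply: (mulIf ab); rewrite -brM transport_fst transport_snd brZl brZr; field.
exact: z0.
Qed.
End Eigen.

Lemma transportK a b z t : br a b != 0 -> z != 0 -> z ^+ 2 = 1 - t ->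
  transport b a z t *m transport a b z t = 1%:M.
Proof.
move=> ab z0 zt; have ba : br b a != 0 by rewrite br_anti oppr_eq0.
have fa := transport_fst a b z t; have fb := transport_fst b a z t.
have sa := transport_snd ab z0 zt; have sb := transport_snd ba z0 zt.
move: (transport _ _ _ _) (transport _ _ _ _) fa fb sa sb => M N fa fb sa sb.
apply: (mx_eq_basis ab); rewrite -mulmxA mul1mx.
  by rewrite fa -scalemxAr sb scalerA mulVf ?scale1r.
by rewrite sa -scalemxAr fb scalerA mulfV ?scale1r.
Qed.

(** The two products are compared on the basis [a], [b]. On [a], both give a multiple of [a] minus a
    multiple of [c], and equality of the coefficients of [c] is the cross ratio condition [crt]. On
    [b], the same condition is combined with the expansion of [b] in [c] and [d]. *)
Lemma transport_face a b c d z1 z2 t1 t2 (K : C) :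
  br a b * br c d = K * (br b c * br d a) -> K * t2 = t1 ->
  z1 != 0 -> z2 != 0 -> z1 ^+ 2 = 1 - t1 ->
  br a b != 0 -> br b c != 0 -> br c d != 0 -> br d a != 0 ->
  transport b c z2 t2 *m transport a b z1 t1 =
  transport d c z1 t1 *m transport a d z2 t2.
Proof.
move=> cr Kt z10 z20 zt1 ab bc cd da.
have dc : br d c != 0 by rewrite br_anti oppr_eq0.
have ad : br a d != 0 by rewrite br_anti oppr_eq0.
have crt : t2 * (br a b * br c d) = t1 * (br b c * br d a).
  by rewrite cr -Kt; ring.
have ba : br b a = - br a b := br_anti b a.
have aa := transport_fst a b z1 t1; have ad' := transport_fst a d z2 t2.
have db := transport_fst d c z1 t1; have bb := transport_fst b c z2 t2.
have sb := transport_snd ab z10 zt1.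
have Ba v := transportE b c z2 t2 v; have Da v := transportE d c z1 t1 v.
have Ad v := transportE a d z2 t2 v.
move: (transport a b z1 t1) (transport b c z2 t2) (transport d c z1 t1)
  (transport a d z2 t2) aa ad' db bb sb Ba Da Ad => Tab Tbc Tdc Tad aa ad' db bb sb Ba Da Ad.
apply: (mx_eq_basis ab); rewrite -!mulmxA.
  rewrite aa ad' -!scalemxAr Ba Da !scalerA mulrC.
  congr (_ *: (_ - _ *: _)); rewrite ba (br_anti d c).
  apply: (mulIf (mulf_neq0 bc cd)); transitivity (- (t2 * (br a b * br c d))); first by field.
  by rewrite crt; field.
rewrite sb Ad -!scalemxAr bb mulmxBr -scalemxAr db Da.
have -> : t2 * (br a b / br a d) = - (t1 * (br b c / br c d)).
  apply: (mulIf (mulf_neq0 ad cd)); transitivity (t2 * (br a b * br c d)); first by field.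
  by rewrite crt (br_anti d a); field.
have z1E : z1 = z1^-1 * (1 - t1) by rewrite -zt1; field.
have bE := br_span b cd; rewrite (br_anti d b) (br_anti d c) invrN mulrNN.
rewrite (br_anti c b) in bE.
move: (br b d / br c d) (z2^-1) bE z1E => X Y; rewrite mulNr.
move: (br b c / br c d) (z1^-1) => Z W bE z1E.
apply/matrixP => k l; have := congr1 (fun v : 'cV[C]_2 => v k l) bE; rewrite !mxE => bkl.
rewrite {1}z1E; transitivity (Y * (W * (b k l - t1 * b k l))); first by ring.
by rewrite {2}bkl; ring.
Qed.
End Transport.

(** * Edge factors, diagonals and cross ratios of a given surface *)

Lemma gauss_section (R : realType) (mu : R) (x : surface R) (G : gauss_map R) :
  (mu != 0 -> constant_mean_curvature mu x G (Num.sqrt `|mu|)^-1) ->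
  (mu = 0 -> intrinsically_flat x G) ->
  (forall i j, edge predT i j -> x i != x j) ->
  curvature_setting mu x G /\ exists g : surface R,
    [/\ section_G G g, edge_parallel x g &
      forall i j k l, face predT i j k l -> mixed_area x g i j k l = 0].
Proof.
have [->|mu0] := eqVneq mu 0 => hc hf hx; first by have [hs [g hg]] := hf erefl; split=> //; exists g.
have [hs [g [h1 h2 h3 h4]]] := hc isT; split=> //; exists g.
have s0 : Num.sqrt `|mu| != 0 by rewrite sqrtr_eq0 -ltNge normr_gt0.
move: h3 h4 s0; move: (Num.sqrt `|mu|) => s h3 h4 s0.
pose n : surface R := fun i => s^-1 *: (g i - x i).
have gn i : g i = s *: n i + x i.
  by rewrite /n scalerA mulfV // scale1r subrK.
have dg i j : g i - g j = s *: (n i - n j) + (x i - x j).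
  by rewrite !gn scalerBr opprD addrACA.
split=> // [i j e|i j k l f].
  have d0 : x i - x j != 0 by rewrite subr_eq0 hx.
  have [c hc'] := dim_span2_le1P d0 (h3 i j e).
  apply: (@dim_span2_le1 _ _ _ (s * c + 1)).
  by rewrite dg hc' scalerA scalerDl scale1r.
(* Substituting $g=sn+x$ gives $A(x,g)=sA(x,n)+A(x,x)$, which is [s] times the expression in the
   mean curvature equation with $H=1/s$. *)
transitivity (s *: (mixed_area x n i j k l + s^-1 *: mixed_area x x i j k l)).
  rewrite /mixed_area !dg; clearbody n.
  move: (x i - x k) (x j - x l) (n j - n l) (n i - n k) => a1 a2 a3 a4.
  rewrite !wedgeDr !wedgeZr; move: (wedge a1 a3) (wedge a1 a2) (wedge a2 a4) (wedge a2 a1).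
  move=> W1 W2 W3 W4; by apply/matrixP => a b; rewrite !mxE; field.
by rewrite h4 // scaler0.
Qed.

Section IsothermicData.
Context {R : realType} (mu : R) (x : surface R) (G : gauss_map R) (g : surface R).
Context (setting : curvature_setting mu x G) (nondeg : area_nondegenerate x)
  (adm : admissible x G) (hg : section_G G g) (par : edge_parallel x g)
  (area0 : forall i j k l, face predT i j k l -> mixed_area x g i j k l = 0).
Implicit Types i j k l : vertex.

Lemma edge_factorE i j : edge_factor x G i j = mdot (x j) (g j) / mdot (x i) (g j).
Proof.
have [g0 gG] := hg j; rewrite /edge_factor.
have : vpick (G j) \in G j by exact: memv_pick.
rewrite -{2}gG => /vlineP[c hc].
have c0 : c != 0.
  have : vpick (G j) != 0 by rewrite vpick0 -gG -dimv_eq0 dim_vline g0.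
  by apply: contraNneq => c0; rewrite hc c0 scale0r.
by rewrite hc !mdotZr -mulf_div mulfV // mul1r.
Qed.

Lemma edge_factor_neq1 i j : edge predT i j -> edge_factor x G i j != 1.
Proof.
move=> e; have [k [l f]] := edge_face e; have [_ h] := adm.
by apply: contraTneq (h _ _ _ _ f) => ->; rewrite subrr mul0r ltxx.
Qed.

Lemma mdot_xg_neq0 i : mdot (x i) (g i) != 0.
Proof.
have [_ _ no _] := setting; apply/eqP => h; apply: (no i) => v.
by have [_ <-] := hg i => /vlineP[c ->]; rewrite mdotZr h mulr0.
Qed.

Lemma mdot_gg i : mdot (g i) (g i) = 0.
Proof.
have [_ [hn _ _] _ _] := setting; have [_ h] := hn i; apply: h.
by have [_ <-] := hg i; rewrite memv_line.
Qed.

Lemma mdot_cross_neq0 i j : edge predT i j -> mdot (x i) (g j) != 0.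
Proof.
move=> e; have [h _] := adm; apply: contraNneq (h _ _ e) => h0.
have [_ gG] := hg j; have : vpick (G j) \in G j by exact: memv_pick.
by rewrite -{2}gG => /vlineP[c ->]; rewrite mdotZr h0 mulr0.
Qed.

Lemma dx_g_neq0 i j : edge predT i j -> mdot (x i - x j) (g j) != 0.
Proof.
move=> e; have := edge_factor_neq1 e; apply: contraNneq; rewrite mdotBl => /eqP.
rewrite subr_eq0 => /eqP h; rewrite edge_factorE h divff // mdot_xg_neq0 //.
Qed.

(** If $g_i=g_j$, then $L_i$ and $L_j$ have the same direction; since they meet, $x_i-x_j\in G_j$
    would be orthogonal to $g_j$, and the edge factor would be 1. *)
Lemma edge_ratio i j : edge predT i j ->
  exists2 c, c != 0 & g i - g j = c *: (x i - x j).
Proof.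
move=> e; have dg0 := dx_g_neq0 e.
have d0 : x i - x j != 0.
  by apply: contraNneq dg0 => ->; rewrite mdotC mdot0r.
have [c hc] := dim_span2_le1P d0 (par e); exists c => //.
apply: contraNneq dg0 => c0; move: hc; rewrite c0 scale0r => /eqP.
rewrite subr_eq0 => /eqP gij.
have [_ [_ hL _] _ _] := setting; have [v [hi hj]] := hL i j e.
have Gij : G i = G j by have [_ <-] := hg i; have [_ <-] := hg j; rewrite gij.
move: hi hj; rewrite /on_line Gij => hi hj.
have : x i - x j \in G j.
  have -> : x i - x j = (v - x j) - (v - x i) by apply/rowP => n; rewrite !mxE; ring.
  by rewrite memvB.
by have [_ <-] := hg j => /vlineP[a ->]; rewrite mdotZl mdot_gg mulr0.
Qed.

(** Both $x$ and $g$ have constant length, so each sum over the ends of an edge is orthogonal to the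
    corresponding difference. As $dx$ and $dg$ are parallel, $dg\perp x_i+x_j$ and $dx\perp
    g_i+g_j$; the claims are the sum and the difference of these equations. *)
Lemma edge_mdot i j : edge predT i j ->
  mdot (x i) (g i) = mdot (x j) (g j) /\ mdot (x i) (g j) = mdot (x j) (g i).
Proof.
move=> e; have [c c0 h] := edge_ratio e; have [_ _ _ hx] := setting.
have h1 : mdot (g i - g j) (x i + x j) = 0.
  rewrite h mdotZl mdotDr !mdotBl !hx (mdotC (x j) (x i)); ring.
have h2 : mdot (x i - x j) (g i + g j) = 0.
  apply: (mulfI c0); rewrite mulr0 -mdotZl -h mdotDr !mdotBl !mdot_gg (mdotC (g j) (g i)); ring.
move: h1 h2; rewrite !mdotDr !mdotBl !(mdotC (g _) (x _)).
by move=> h1 h2; split; lra.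
Qed.

Lemma edge_factor_sym i j : edge predT i j -> edge_factor x G i j = edge_factor x G j i.
Proof. by move=> e; rewrite !edge_factorE; have [-> ->] := edge_mdot e. Qed.

Lemma edge_factor_neq0 i j : edge predT i j -> edge_factor x G i j != 0.
Proof.
move=> e; rewrite edge_factorE mulf_neq0 ?mdot_xg_neq0 // invr_eq0.
exact: mdot_cross_neq0.
Qed.

(** The diagonals [p], [q] of $x$ are independent because $A(x,x)\ne0$. Let $P$ be the [p]-component
    of $g_i-g_k$ and $Q$ the [q]-component of $g_j-g_l$. Closing of the quadrilateral of $g$ gives
    $P=Q$, and $A(x,g)=0$ gives $P=-Q$, so both vanish. *)
Lemma face_diagonal i j k l : face predT i j k l ->
  exists2 r, r != 0 & g i - g k = r *: (x j - x l).
Proof.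
move=> f; have [[eij ejk ekl eli elk] eil] := face_edges f.
have [s1 s10 h1] := edge_ratio eij; have [s2 s20 h2] := edge_ratio ejk.
have [s3 s30 h3] := edge_ratio ekl; have [s4 s40 h4] := edge_ratio eli.
have [[pl _] _ _ _] := setting.
have := pl _ _ _ _ f => {}pl.
set p := x i - x k; set q := x j - x l.
have fr : free [:: p; q].
  apply: wedge_neq0; apply: contraNneq (nondeg f) => h.
  by rewrite /mixed_area -/p -/q h [wedge q p]wedgeC h oppr0 subr0 scaler0.
have mi (a : 'rV[R]_4) : a \in [:: x j - x i; x k - x i; x l - x i] ->
    a \in <<[:: x j - x i; x k - x i; x l - x i]>>%VS by exact: memv_span.
have pin : p \in <<[:: x j - x i; x k - x i; x l - x i]>>%VS.
  by rewrite /p -opprB memvN mi // !inE eqxx orbT.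
have qin : q \in <<[:: x j - x i; x k - x i; x l - x i]>>%VS.
  have -> : q = (x j - x i) - (x l - x i) by apply/rowP => n; rewrite !mxE; ring.
  by rewrite memvB // mi // !inE eqxx ?orbT.
have din : x j - x i \in <<[:: x j - x i; x k - x i; x l - x i]>>%VS.
  by rewrite mi // mem_head.
have [a' [b hd]] := dim_span_le2P fr pin qin pl din.
pose a := - a'.
have e1 : x i - x j = a *: p - b *: q by rewrite -opprB hd opprD scaleNr.
have e2 : x j - x k = b *: q - (a - 1) *: p.
  have -> : x j - x k = p - (x i - x j) by apply/rowP => n; rewrite !mxE; ring.
  by rewrite e1 scalerBl scale1r; apply/rowP => n; rewrite !mxE; ring.
have e3 : x k - x l = (a - 1) *: p - (b - 1) *: q.
  have -> : x k - x l = q - (x j - x k) by apply/rowP => n; rewrite !mxE; ring.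
  by rewrite e2 [(b - 1) *: q]scalerBl scale1r; apply/rowP => n; rewrite !mxE; ring.
have e4 : x l - x i = (b - 1) *: q - a *: p.
  have -> : x l - x i = - q - (x i - x j) by apply/rowP => n; rewrite !mxE; ring.
  by rewrite e1 scalerBl scale1r; apply/rowP => n; rewrite !mxE; ring.
have gik : g i - g k = (s1 * a - s2 * (a - 1)) *: p + (s2 * b - s1 * b) *: q.
  have -> : g i - g k = (g i - g j) + (g j - g k) by apply/rowP => n; rewrite !mxE; ring.
  by rewrite h1 h2 e1 e2; apply/rowP => n; rewrite !mxE; ring.
have gik' : g i - g k = (s4 * a - s3 * (a - 1)) *: p + (s3 * (b - 1) - s4 * (b - 1)) *: q.
  have -> : g i - g k = - ((g k - g l) + (g l - g i)) by apply/rowP => n; rewrite !mxE; ring.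
  by rewrite h3 h4 e3 e4; apply/rowP => n; rewrite !mxE; ring.
have gjl : g j - g l = (s3 * (a - 1) - s2 * (a - 1)) *: p + (s2 * b - s3 * (b - 1)) *: q.
  have -> : g j - g l = (g j - g k) + (g k - g l) by apply/rowP => n; rewrite !mxE; ring.
  by rewrite h2 h3 e2 e3; apply/rowP => n; rewrite !mxE; ring.
have [E1 E2] := free2_eq fr (etrans (esym gik) gik').
have := area0 f; rewrite /mixed_area -/p -/q gjl gik !wedgeDr !wedgeZr !wedge_self.
rewrite [wedge q p]wedgeC !scaler0 add0r addr0 scalerN opprK -scalerDl => /eqP.
have wpq : wedge p q != 0.
  apply: contraNneq (nondeg f) => h.
  by rewrite /mixed_area -/p -/q h [wedge q p]wedgeC h oppr0 subr0 scaler0.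
rewrite !scaler_eq0 (negPf wpq) orbF invr_eq0 pnatr_eq0 /= => /eqP E3.
have P0 : s1 * a - s2 * (a - 1) = 0.
  have Q2 : s1 * b - s4 * (b - 1) = s2 * b - s3 * (b - 1) by lra.
  suff PQ : s1 * a - s2 * (a - 1) = s2 * b - s3 * (b - 1) by lra.
  transitivity (b * (s1 * a - s2 * (a - 1)) - (b - 1) * (s4 * a - s3 * (a - 1))).
    by rewrite -E1; ring.
  transitivity (a * (s1 * b - s4 * (b - 1)) - (a - 1) * (s2 * b - s3 * (b - 1))).
    by ring.
  by rewrite Q2; ring.
have Q0 : s2 * b - s3 * (b - 1) = 0 by lra.
exists (s2 * b - s1 * b); last by rewrite P0 scale0r add0r.
(* For $b=0$ the equation [Q0] reads $s_3=0$; below, for $s_1=s_2$ the equation [P0] reads $s_1=0$.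
   Edge ratios are nonzero, so the diagonal factor $b(s_2-s_1)$ is too. *)
have b0 : b != 0.
  apply/eqP => b0; move/eqP: Q0; rewrite b0 mulr0 !sub0r mulrN opprK mulr1.
  by rewrite (negPf s30).
rewrite -mulrBl mulf_neq0 // subr_eq0; apply/eqP => s12.
by move/eqP: P0; rewrite s12 -mulrBr opprB addrC subrK mulr1 (negPf s10).
Qed.

(** For null vectors $g_i+g_k\perp g_i-g_k$, so $g_i+g_k$ is orthogonal to $x_j-x_l$, and likewise
    for the other diagonals. With [edge_mdot] this equates the denominators of the edge factors on
    opposite edges; the numerators already agree. *)
Lemma face_factor i j k l : face predT i j k l ->
  edge_factor x G i j = edge_factor x G l k /\ edge_factor x G i l = edge_factor x G j k.
Proof.
move=> f; have [[eij ejk ekl eli elk] eil] := face_edges f.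
have [r r0 h] := face_diagonal f; have [r' r'0 h'] := face_diagonal (face_rot f).
have H : mdot (x j - x l) (g i + g k) = 0.
  by apply: (mulfI r0); rewrite mulr0 -mdotZl -h mdotDr !mdotBl !mdot_gg (mdotC (g k) (g i)); ring.
have H' : mdot (x k - x i) (g j + g l) = 0.
  by apply: (mulfI r'0); rewrite mulr0 -mdotZl -h' mdotDr !mdotBl !mdot_gg (mdotC (g j) (g l)); ring.
move: H H'; rewrite !mdotDr !mdotBl !edge_factorE.
have [a1 b1] := edge_mdot eij; have [a2 b2] := edge_mdot ejk.
have [a3 b3] := edge_mdot elk; have [a4 b4] := edge_mdot eil.
move=> H H'; have -> : mdot (x i) (g j) = mdot (x l) (g k) by lra.
have -> : mdot (x i) (g l) = mdot (x j) (g k) by lra.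
by rewrite a2 -a3 -a4 a1 a2.
Qed.

Definition tau i j : R := 1 - (edge_factor x G i j)^-1.

Lemma tau_neq0 i j : edge predT i j -> tau i j != 0.
Proof.
move=> e; rewrite subr_eq0 eq_sym -[X in _ == X]invr1 (inj_eq invr_inj).
exact: edge_factor_neq1.
Qed.

(* c is the common value of (x, g) at both ends of the edge *)
Lemma edge_tau i j c : edge predT i j -> g i - g j = c *: (x i - x j) ->
  mdot (g i) (g j) = - c * (mdot (x i) (g i) * tau i j).
Proof.
move=> e h; have := congr1 (fun v => mdot v (g j)) h.
have [a b] := edge_mdot e; rewrite /= mdotZl !mdotBl mdot_gg subr0 /tau edge_factorE => ->.
rewrite -a invf_div; field.
exact: mdot_xg_neq0.
Qed.

Section Spinors.
Context (w : vertex -> 'cV[R[i]]_2) (ga : vertex -> R).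
Context (gw : forall i, g i = ga i *: nv (w i)).

Lemma ga_neq0' i : ga i != 0.
Proof.
by have [g0 _] := hg i; apply: contraNneq g0 => h; rewrite gw h scale0r.
Qed.

Lemma w_neq0' i : w i != 0.
Proof.
by have [g0 _] := hg i; apply: contraNneq g0 => h; rewrite gw scaler_eq0 nv_eq0 h eqxx orbT.
Qed.

Lemma mdot_gg_w i j : mdot (g i) (g j) = - 2^-1 * (ga i * ga j * nsq (br (w i) (w j))).
Proof. by rewrite !gw mdotZl mdotZr mdot_nvnv; ring. Qed.

Lemma br_edge_neq0 i j : edge predT i j -> br (w i) (w j) != 0.
Proof.
move=> e; have [c c0 h] := edge_ratio e; apply/eqP => b0.
have := edge_tau e h; rewrite mdot_gg_w b0 nsq_real expr0n /= !mulr0 => /esym/eqP.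
apply/negP; apply: (mulf_neq0 _ (mulf_neq0 (mdot_xg_neq0 i) (tau_neq0 e))).
by rewrite oppr_eq0.
Qed.

(** If $G_j=G_l$, then $(x_k-x_i,g_j)=0$, so the edges [ij] and [jk] have the same edge factor, and
    by [face_factor] so has [il]. The product required to be negative would then be a square. *)
Lemma br_diag_neq0 i j k l : face predT i j k l -> br (w j) (w l) != 0.
Proof.
move=> f; have [r r0 h] := face_diagonal (face_rot f).
have [[eij ejk ekl eli elk] eil] := face_edges f.
have [f1 f2] := face_factor f; apply/eqP => b0.
have h0 : mdot (x k - x i) (g j) = 0.
  apply: (mulfI r0); rewrite mulr0 -mdotZl -h mdotBl mdot_gg mdot_gg_w (br_anti (w l)) b0.
  by rewrite oppr0 nsq_real expr0n /= !mulr0 subr0.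
have := (proj2 adm) _ _ _ _ f; rewrite f2 (edge_factor_sym ejk) !edge_factorE.
have -> : mdot (x k) (g j) = mdot (x i) (g j).
  by apply/eqP; rewrite -subr_eq0 -mdotBl h0.
by rewrite -expr2 ltNge sqr_ge0.
Qed.

(** Parallel edges and diagonals give $g_k$ as a real combination of $g_i,g_j,g_l$. Polarising this
    Hermitian identity at pairs of different spinors retains phases, and so yields the complex cross
    ratio and not just its modulus. *)
Lemma face_cross_spinor i j k l : face predT i j k l ->
  br (w i) (w j) * br (w k) (w l) =
    (tau i j / tau i l)%:C * (br (w j) (w k) * br (w l) (w i)).
Proof.
move=> f; have [[eij ejk ekl eli elk] eil] := face_edges f.
have [c1 c10 h1] := edge_ratio eij; have [c2 c20 h2] := edge_ratio eil.
have [r r0 h] := face_diagonal f.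
have t1 := edge_tau eij h1; have t2 := edge_tau eil h2.
have ij := br_edge_neq0 eij; have il := br_edge_neq0 eil; have jl := br_diag_neq0 f.
have x0 := mdot_xg_neq0 i; have gi0 := ga_neq0' i.
have gj0 := ga_neq0' j; have gl0 := ga_neq0' l.
have tij := tau_neq0 eij; have til := tau_neq0 eil.
move: t1 t2; rewrite !mdot_gg_w => t1 t2.
have E : ga k *: nv (w k) = (ga i - r / c2 * ga i + r / c1 * ga i) *: nv (w i)
    + (r / c2 * ga l) *: nv (w l) + (- (r / c1 * ga j)) *: nv (w j).
  have e1 : x i - x j = c1^-1 *: (g i - g j) by rewrite h1 scalerA mulVf ?scale1r.
  have e2 : x i - x l = c2^-1 *: (g i - g l) by rewrite h2 scalerA mulVf ?scale1r.
  have -> : ga k *: nv (w k) = g i - r *: ((x i - x l) - (x i - x j)).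
    rewrite -gw; have -> : g k = g i - (g i - g k) by apply/rowP => n; rewrite !mxE; ring.
    by rewrite h; apply/rowP => n; rewrite !mxE; ring.
  rewrite e1 e2 !gw; move: (nv (w i)) (nv (w j)) (nv (w l)) => A B D.
  by apply/rowP => n; rewrite !mxE; ring.
have hqE (P Q S T : R) (a b : 'cV[R[i]]_2) (v1 v2 v3 v4 : 'cV[R[i]]_2) :
    T *: nv v4 = P *: nv v1 + Q *: nv v2 + S *: nv v3 ->
    T%:C * (br a v4 * (br b v4)^*%R) = P%:C * (br a v1 * (br b v1)^*%R)
     + Q%:C * (br a v2 * (br b v2)^*%R) + S%:C * (br a v3 * (br b v3)^*%R).
  rewrite -!hq_outer -!herm_nv; move: (nv v1) (nv v2) (nv v3) (nv v4) => n1 n2 n3 n4.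
  move=> /(congr1 (fun v => hq (herm v) a b)).
  by rewrite !hermD !hermZ !hqD !hqZ.
(* At $(w_i,w_l)$ and $(w_i,w_j)$ only one term survives on the right. Eliminating [br (w i) (w k)]
   from the two equations leaves [E3]. *)
have := hqE _ _ _ _ (w i) (w l) _ _ _ _ E; have := hqE _ _ _ _ (w i) (w j) _ _ _ _ E.
rewrite !br_self !conjC0 !mul0r !mulr0 !add0r !addr0 => E1 E2.
have E3 : (r / c2 * ga l)%:C * (br (w i) (w l) * (br (w j) (w l))^*%R) * (br (w l) (w k))^*%R
   = (- (r / c1 * ga j))%:C * (br (w i) (w j) * (br (w l) (w j))^*%R) * (br (w j) (w k))^*%R.
  by rewrite -E1 -E2; ring.
have q1 : c1^-1 * ga j = 2 * (mdot (x i) (g i) * tau i j) / (ga i * nsq (br (w i) (w j))).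
  rewrite -nsq_eq0 in ij; apply: (mulfI (mulf_neq0 c10 (mulf_neq0 gi0 ij))).
  transitivity (ga i * ga j * nsq (br (w i) (w j))); first by field.
  transitivity (2 * (c1 * (mdot (x i) (g i) * tau i j))); last by field; nz.
  by lra.
have q2 : c2^-1 * ga l = 2 * (mdot (x i) (g i) * tau i l) / (ga i * nsq (br (w i) (w l))).
  rewrite -nsq_eq0 in il; apply: (mulfI (mulf_neq0 c20 (mulf_neq0 gi0 il))).
  transitivity (ga i * ga l * nsq (br (w i) (w l))); first by field.
  transitivity (2 * (c2 * (mdot (x i) (g i) * tau i l))); last by field; nz.
  by lra.
move: E3; rewrite -!mulrA q1 q2.
have X0 : 2 * mdot (x i) (g i) / ga i != 0 by rewrite !mulf_neq0 ?invr_eq0 ?pnatr_eq0.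
have [n1 n2] : nsq (br (w i) (w j)) != 0 /\ nsq (br (w i) (w l)) != 0 by rewrite !nsq_eq0.
have -> : r * (2 * (mdot (x i) (g i) * tau i l) / (ga i * nsq (br (w i) (w l)))) =
   (r * (2 * mdot (x i) (g i) / ga i)) * (tau i l / nsq (br (w i) (w l))) by field; nz.
have -> : - (r * (2 * (mdot (x i) (g i) * tau i j) / (ga i * nsq (br (w i) (w j))))) =
   - (r * (2 * mdot (x i) (g i) / ga i)) * (tau i j / nsq (br (w i) (w j))) by field; nz.
have := mulf_neq0 r0 X0; rewrite -(fmorph_eq0 (real_complex R)) /=.
move: (r * _) => Y Y0.
have conj0 (a : R[i]) : a != 0 -> a^*%R != 0 by rewrite conjC_eq0.
rewrite (br_anti (w l) (w j)) (br_anti (w l) (w i)) (br_anti (w k) (w l)) !rmorphN !rmorphM !fmorphV /= !nsqE.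
have tC : (tau i l)%:C != 0 :> R[i] by rewrite fmorph_eq0.
have := conj0 _ il; have := conj0 _ ij; have := conj0 _ jl; move: il ij.
move: (br (w i) (w l)) (br (w i) (w j)) (br (w j) (w l)) (br (w l) (w k)) (br (w j) (w k)).
move=> IL IJ JL LK JK il ij jl1 ij1 il1 H.
have H2 : (tau i l)%:C * LK^*%R * IJ^*%R = (tau i j)%:C * JK^*%R * IL^*%R.
  apply: (mulfI (mulf_neq0 Y0 jl1)).
  transitivity (Y%:C * ((tau i l)%:C / (IL * IL^*%R)) * (IL * (JL^*%R * LK^*%R))
    * IJ^*%R * IL^*%R); first by field; nz.
  rewrite H rmorphN /=; field. apply/andP; split; [exact: ij1 | exact: ij]. 
(* [H2] is the complex conjugate of the wanted relation; its coefficients are real. *)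
have := congr1 (fun v => v^*%R) H2.
rewrite !rmorphM /= !conjR !conjCK => H3.
apply: (mulfI tC); transitivity (- ((tau i l)%:C * LK * IJ)); first by ring.
by rewrite H3; field.
Qed.

(** Since $dx$ is a combination of the squares of $w_i$ and $w_j$, the mixed values of the forms of
    $x_i$ and $x_j$ agree, and the diagonal values are governed by the edge factor. The transport
    gives the mixed value a factor $z/\bar z=\pm1$, which the sign of the edge factor cancels. *)
Lemma herm_transport i j (z : R[i]) : edge predT i j ->
  z ^+ 2 = (1 - tau i j)%:C ->
  herm (x j) = (Num.sg (edge_factor x G i j))%:C *:
    (transport (w i) (w j) z (tau i j)%:C *m herm (x i)
      *m dagger (transport (w i) (w j) z (tau i j)%:C)).
Proof.
move=> e hz; have ab := br_edge_neq0 e.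
have lE : 1 - tau i j = (edge_factor x G i j)^-1 by rewrite /tau opprB addrC subrK.
have l0 := edge_factor_neq0 e; rewrite lE in hz.
have cz := conj_sqrt_real hz; rewrite sgrV in cz.
have z0 : z != 0.
  apply/eqP => z0; move: hz; rewrite z0 expr0n /= => /esym/eqP.
  by rewrite fmorph_eq0 invr_eq0 (negPf l0).
have hz' : z ^+ 2 = 1 - (tau i j)%:C by rewrite hz -lE rmorphB rmorph1.
have dt := transport_det ab z0 hz'.
have fa := transport_fst (w i) (w j) z (tau i j)%:C; have fb := transport_snd ab z0 hz'.
move: (transport _ _ _ _) dt fa fb => T dt fa fb.
have hT X a b : hq (T *m X *m dagger T) (T *m a) (T *m b) = hq X a b.
  by rewrite hqM dt conjC1 !mul1r.
have sg2 : (Num.sg (edge_factor x G i j))%:C ^+ 2 = 1 :> R[i].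
  by rewrite -rmorphXn /= sqr_sg l0.
have aE : w i = z *: (T *m w i) by rewrite fa scalerA mulfV // scale1r.
have bE : w j = z^-1 *: (T *m w j) by rewrite fb scalerA mulVf // scale1r.
have hx a c : (mdot (x c) (g a))%:C = - 2^-1 * (ga a)%:C * hq (herm (x c)) (w a) (w a).
  by rewrite gw mdotZr rmorphM /= mdot_nv; ring.
have gC a : (- 2^-1 * (ga a)%:C : R[i]) != 0.
  by rewrite mulf_neq0 ?fmorph_eq0 ?ga_neq0' // oppr_eq0 invr_eq0 pnatr_eq0.
have x0 := mdot_xg_neq0 i; have [m1 m2] := edge_mdot e; have c0 := mdot_cross_neq0 e.
have [c cn0 hc] := edge_ratio e.
have sgn : (Num.sg (edge_factor x G i j))%:C != 0 :> R[i] by rewrite fmorph_eq0 sgr_eq0.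
have czV : (z^-1)^*%R = (Num.sg (edge_factor x G i j))%:C * z^-1.
  rewrite fmorphV /= cz invfM; congr (_ * _).
  by apply: (mulfI sgn); rewrite mulfV // -expr2 sg2.
have Xij : herm (x j) = herm (x i) + (- c^-1 * ga i)%:C *: outer (w i) (w i)
    + (c^-1 * ga j)%:C *: outer (w j) (w j).
  have -> : x j = x i - c^-1 *: (g i - g j).
    by rewrite hc scalerA mulVf // scale1r; apply/rowP => n; rewrite !mxE; ring.
  rewrite hermB hermZ hermB !gw !hermZ !herm_nv.
  move: (herm _) (outer _ _) (outer _ _) => A B D.
  by apply/matrixP => k l; rewrite !mxE; ring.
have hij : hq (herm (x j)) (w i) (w j) = hq (herm (x i)) (w i) (w j).
  by rewrite Xij !hqD !hqZ !hq_outer !br_self conjC0 !mul0r !mulr0 !addr0.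
have hji : hq (herm (x j)) (w j) (w i) = hq (herm (x i)) (w j) (w i).
  by rewrite Xij !hqD !hqZ !hq_outer !br_self conjC0 !mul0r !mulr0 !addr0.
have tr a b p q : hq (T *m herm (x i) *m dagger T) (p *: (T *m a)) (q *: (T *m b)) =
    p * q^*%R * hq (herm (x i)) a b by rewrite hqZl hqZr hT mulrA.
apply: (hq_inj ab); rewrite hqZ.
- rewrite [in RHS]aE hqZl hqZr hT cz.
  apply: (mulfI (gC i)); rewrite -hx.
  transitivity ((Num.sg (edge_factor x G i j))%:C ^+ 2 * z ^+ 2 * (- 2^-1 * (ga i)%:C * hq (herm (x i)) (w i) (w i))); last by ring.
  rewrite -hx sg2 mul1r hz -rmorphM; congr (_%:C).
  rewrite edge_factorE -m1 -m2; field; nz.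
- rewrite hij [in RHS]aE [in RHS]bE tr czV.
  transitivity ((Num.sg (edge_factor x G i j))%:C ^+ 2 * hq (herm (x i)) (w i) (w j)).
    by rewrite sg2 mul1r.
  by field.
- rewrite hji [in RHS]aE [in RHS]bE tr cz.
  transitivity ((Num.sg (edge_factor x G i j))%:C ^+ 2 * hq (herm (x i)) (w j) (w i)).
    by rewrite sg2 mul1r.
  by field.
rewrite [in RHS]bE tr czV.
apply: (mulfI (gC j)); rewrite -hx.
transitivity ((Num.sg (edge_factor x G i j))%:C ^+ 2 * (z ^+ 2)^-1 *
  (- 2^-1 * (ga j)%:C * hq (herm (x i)) (w j) (w j))); last by field.
rewrite -hx sg2 mul1r hz -fmorphV -rmorphM; congr (_%:C).
by rewrite invrK edge_factorE; field; nz.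
Qed.
End Spinors.
End IsothermicData.

(** * Integration of flat transports over a rectangle *)

Section Integration.

Definition grid (p : vertex) (a b : nat) : vertex := (p.1 + a%:Z, p.2 + b%:Z).

Lemma grid_edge1 p a b : edge predT (grid p a b) (grid p a.+1 b).
Proof. by rewrite /edge /grid /=; lia. Qed.

Lemma grid_edge2 p a b : edge predT (grid p a b) (grid p a b.+1).
Proof. by rewrite /edge /grid /=; lia. Qed.

Lemma grid_face p a b :
  face predT (grid p a b) (grid p a.+1 b) (grid p a.+1 b.+1) (grid p a b.+1).
Proof. by rewrite /face /edge /grid -!pair_eqE /pair_eq /=; lia. Qed.

Lemma rectangle_grid p q i : rectangle p q i ->
  i = grid p `|i.1 - p.1|%N `|i.2 - p.2|%N.
Proof.
case: i => i1 i2; rewrite /rectangle /grid /= => h.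
by congr (_, _); lia.
Qed.

(* Z^2 is simply connected: a flat transport of states T, reversible on the
   states satisfying the invariant I, has a parallel section. *)
Lemma flat_section (S : Type) (T : vertex -> vertex -> S -> S)
    (I : vertex -> S -> Prop) (p q : vertex) (s0 : S) :
  (forall i j s, edge predT i j -> I i s -> I j (T i j s)) ->
  (forall i j s, edge predT i j -> T j i (T i j s) = s) ->
  (forall i j k l s, face predT i j k l -> T j k (T i j s) = T l k (T i l s)) ->
  I p s0 ->
  exists f : vertex -> S, (forall i, rectangle p q i -> I i (f i)) /\
    forall i j, edge (rectangle p q) i j -> f j = T i j (f i).
Proof.
move=> TI TK TF I0.
(* Transport runs along the bottom row and then up the columns. The remaining horizontal edges are
   compatible by flatness on faces ([hor]), and edges traversed backwards by reversibility. *)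
pose row := fix row a := if a is a'.+1 then T (grid p a' 0) (grid p a 0) (row a') else s0.
pose F := fix F a b := if b is b'.+1 then T (grid p a b') (grid p a b) (F a b') else row a.
have hor a b : F a.+1 b = T (grid p a b) (grid p a.+1 b) (F a b).
  by elim: b => //= b ->; apply: TF; apply: grid_face.
have FI a b : I (grid p a b) (F a b).
  elim: b => [|b IH] /=; last by apply: TI => //; apply: grid_edge2.
  elim: a => [|a IH] /=; last by apply: TI => //; apply: grid_edge1.
  by case: p I0 {TI TK TF row F hor} => p1 p2; rewrite /grid /= !addr0.
exists (fun i => F `|i.1 - p.1|%N `|i.2 - p.2|%N); split=> [i hi|i j /and3P[hi hj e]].
  by rewrite {1}(rectangle_grid hi).
have gi := rectangle_grid hi; have gj := rectangle_grid hj.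
move: hi hj e; rewrite /rectangle.
set a := `|i.1 - p.1|%N in gi *; set b := `|i.2 - p.2|%N in gi *.
set c := `|j.1 - p.1|%N in gj *; set d := `|j.2 - p.2|%N in gj * => hi hj e.
change (F c d = T i j (F a b)); rewrite [X in T X _]gi [X in T _ X]gj.
have : [\/ c = a.+1 /\ d = b, a = c.+1 /\ d = b, c = a /\ d = b.+1 | c = a /\ b = d.+1].
  have [|[|[|]]] : (c = a.+1 /\ d = b) \/ (a = c.+1 /\ d = b) \/ (c = a /\ d = b.+1) \/ (c = a /\ b = d.+1).
    by rewrite /a /b /c /d; lia.
  - by move=> ?; constructor 1.
  - by move=> ?; constructor 2.
  - by move=> ?; constructor 3.
  - by move=> ?; constructor 4.
case=> -[-> ->] //.
- by rewrite hor TK //; apply: grid_edge1.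
- by rewrite -[F a d.+1]/(T (grid p a d) (grid p a d.+1) (F a d)) TK //; apply: grid_edge2.
Qed.
End Integration.

(** * Frames of a single Hermitian matrix *)

Section BaseFrame.
Context {R : realType}.
Local Notation C := R[i].
Local Notation D mu := (mx2 1 0 0 (- mu%:C)).

(** A Cholesky factorisation: [P] is lower triangular with diagonal $\sqrt a$, $1/\sqrt a$, where
    $a$ is the positive upper left entry of [X]. *)
Lemma hermitian_frame_pos (mu : R) (X : 'M[C]_2) : dagger X = X ->
  \det X = - mu%:C -> 0 < complex.Re (X 0 0) ->
  exists2 P : 'M[C]_2, \det P = 1 & X = P *m D mu *m dagger P.
Proof.
move=> hX dX; have h00 : X 0 0 = (complex.Re (X 0 0))%:C.
  have : X 0 0 = (X 0 0)^*%R by rewrite -daggerE hX.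
  case: (X 0 0) => a b /eqP; rewrite eq_complex /= => /andP[_ /eqP hb].
  by apply/eqP; rewrite eq_complex /= eqxx; apply/eqP; lra.
have h10 : X 1 0 = (X 0 1)^*%R by rewrite -daggerE hX.
move: (complex.Re _) h00 => a h00 a0.
pose r := Num.sqrt a; have r2 : r ^+ 2 = a by rewrite sqr_sqrtr // ltW.
have rC : r%:C != 0 :> C by rewrite fmorph_eq0 sqrtr_eq0 -ltNge.
exists (mx2 r%:C 0 (X 1 0 / r%:C) r%:C^-1).
  by rewrite det2E !mxE /=; field.
have aE : X 0 0 = r%:C ^+ 2 by rewrite h00 -r2 rmorphXn.
have h11 : X 1 1 = (X 0 1 * X 1 0 - mu%:C) / r%:C ^+ 2.
  have : X 0 0 != 0 by rewrite aE expf_neq0.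
  move=> n0; apply: (mulfI n0); move: dX; rewrite det2E => /eqP; rewrite subr_eq => /eqP ->.
  by rewrite -aE; field.
apply: mx2P; rewrite !(mul2E, mxE) /= ?conjC0 ?fmorphV ?rmorphM ?fmorphV /= ?conjR ?h11 ?aE ?h10 ?conjCK; field; nz.
Qed.
Lemma hermitian_frame_row (mu : R) (X M : 'M[C]_2) : dagger X = X ->
  \det X = - mu%:C -> \det M = 1 -> 0 < complex.Re ((M *m X *m dagger M) 0 0) ->
  exists2 P : 'M[C]_2, \det P = 1 & X = P *m D mu *m dagger P.
Proof.
move=> hX dX dM pos.
have ddag (N : 'M[C]_2) : \det (dagger N) = (\det N)^*%R.
  by rewrite !det2E !daggerE; ring.
have dagK (N : 'M[C]_2) : dagger (dagger N) = N.
  by apply/matrixP => a b; rewrite !daggerE conjCK.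
have [|||P dP hP] := @hermitian_frame_pos mu (M *m X *m dagger M).
- by rewrite !daggerM dagK hX mulmxA.
- by rewrite !det_mulmx ddag dM dX conjC1 mul1r mulr1.
- exact: pos.
have uM : M \in unitmx by rewrite unitmxE dM unitr1.
exists (invmx M *m P); first by rewrite det_mulmx det_inv dM invr1 mul1r.
rewrite daggerM !mulmxA -[invmx M *m P *m _]mulmxA.
have -> : invmx M *m (P *m D mu) *m dagger P = invmx M *m (P *m D mu *m dagger P).
  by rewrite !mulmxA.
rewrite -hP !mulmxA mulVmx // mul1mx -mulmxA -daggerM mulVmx //.
have -> : dagger 1%:M = 1%:M :> 'M[C]_2.
  by apply/matrixP => a b; rewrite daggerE !mxE eq_sym rmorph_nat.
by rewrite mulmx1.
Qed.

Lemma hermitian_frame (mu : R) (X : 'M[C]_2) : dagger X = X ->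
  \det X = - mu%:C -> X != 0 ->
  exists e, exists2 P : 'M[C]_2, \det P = 1 &
    [/\ e = 1 \/ e = -1, X = e%:C *: (P *m D mu *m dagger P) &
      (mu <= 0 -> 0 < complex.Re (X 0 0 + X 1 1)) -> e = 1].
Proof.
move=> hX dX X0.
have real_diag (N : 'M[C]_2) k : dagger N = N -> N k k = (complex.Re (N k k))%:C.
  move=> hN; have : N k k = (N k k)^*%R by rewrite -daggerE hN.
  case: (N k k) => a b /eqP; rewrite eq_complex /= => /andP[_ /eqP hb].
  by apply/eqP; rewrite eq_complex /= eqxx; apply/eqP; lra.
have h00 := real_diag X 0 hX; have h11 := real_diag X 1 hX.
have h10 : X 1 0 = (X 0 1)^*%R by rewrite -daggerE hX.
have d1 : \det (1%:M : 'M[C]_2) = 1 by rewrite det1.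
have dag1 : dagger 1%:M = 1%:M :> 'M[C]_2.
  by apply/matrixP => a b; rewrite daggerE !mxE eq_sym rmorph_nat.
pose W : 'M[C]_2 := mx2 0 1 (-1) 0.
have dW : \det W = 1 by rewrite det2E !mxE /=; ring.
have hW (N : 'M[C]_2) : (W *m N *m dagger W) 0 0 = N 1 1.
  by rewrite !(mul2E, mxE) /= conjC0 conjC1; ring.
have base (N : 'M[C]_2) : dagger N = N -> \det N = - mu%:C ->
    0 < complex.Re (N 0 0) \/ 0 < complex.Re (N 1 1) ->
    exists2 P : 'M[C]_2, \det P = 1 & N = P *m D mu *m dagger P.
  move=> hN dN [p|p].
    by apply: (hermitian_frame_row hN dN d1); rewrite mul1mx dag1 mulmx1.
  by apply: (hermitian_frame_row hN dN dW); rewrite hW.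
set a := complex.Re (X 0 0) in h00 *; set c := complex.Re (X 1 1) in h11 *.
have hdet : a * c - nsq (X 0 1) = - mu.
  apply: complexI; rewrite rmorphB rmorphM rmorphN /= nsqE -dX det2E -h00 -h11 h10.
  by [].
have [pa|na] := ltrP 0 a.
  have [|P dP hP] := base X hX dX; first by left.
  by exists 1, P => //; split; [left| rewrite scale1r|].
have [pc|nc] := ltrP 0 c.
  have [|P dP hP] := base X hX dX; first by right.
  by exists 1, P => //; split; [left| rewrite scale1r|].
have [mu0|mu0] := ltrP 0 mu.
  pose n := nsq (X 0 1); have nE : n = mu + a * c by rewrite /n; lra.
  have ac : 0 <= a * c by rewrite mulr_le0.
  have n0 : 0 < n by lra.
  (* The expression is the value of the form at the first row of [M] below. For $c\ne0$ the choice
     $k=-1/c$ gives $-\mu/c>0$; for $c=0$ the value is $2-a>0$. *)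
  have [k hk] : exists k, 0 < a + 2 * k * n + c * k ^+ 2 * n.
    have [c0|c0] := eqVneq c 0.
      exists ((1 - a) / n); rewrite c0 !mul0r addr0 -mulrA divfK ?gt_eqF //; lra.
    exists (- c^-1).
    have -> : a + 2 * - c^-1 * n + c * (- c^-1) ^+ 2 * n = - (mu / c).
      by rewrite nE; field.
    have cn : c < 0 by rewrite lt_neqAle c0.
    by rewrite oppr_gt0 pmulr_rlt0 // invr_lt0.
  pose M : 'M[C]_2 := mx2 1 (k%:C * X 0 1) 0 1.
  have dM : \det M = 1 by rewrite det2E !mxE /=; ring.
  have [|P dP hP] := hermitian_frame_row hX dX dM.
    suff -> : (M *m X *m dagger M) 0 0 = (a + 2 * k * n + c * k ^+ 2 * n)%:C by [].
    rewrite !(mul2E, mxE) /= conjC1 h00 h11 h10.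
    have := nsqE (X 0 1); rewrite -/n => nC.
    by ring: (conjR k) nC.
  by exists 1, P => //; split; [left| rewrite scale1r|].
have hN : dagger (- X) = - X.
  by apply/matrixP => b d; rewrite daggerE !mxE -[in RHS]hX daggerE rmorphN.
have dN : \det (- X) = - mu%:C by rewrite -dX !det2E !mxE; ring.
have [|P dP hP] := base (- X) hN dN.
  have reN (z : C) : complex.Re (- z) = - complex.Re z by case: z.
  rewrite !mxE !reN -/a -/c !oppr_gt0 !lt_neqAle na nc !andbT.
  have [a0|] := eqVneq a 0; last by left.
  have [c0|] := eqVneq c 0; last by right.
  case/eqP: X0; have : nsq (X 0 1) = 0.
    by have := nsq_ge0 (X 0 1); move: hdet; rewrite a0 mul0r; lra.
  move/eqP; rewrite nsq_eq0 => /eqP b0.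
  by apply: mx2P; rewrite ?h10 ?h00 ?h11 ?b0 ?a0 ?c0 mxE ?conjC0 ?rmorph0.
exists (-1), P => //; split; first by right.
  by rewrite -hP rmorphN1 scaleN1r opprK.
have reD (y z : C) : complex.Re (y + z) = complex.Re y + complex.Re z by case: y; case: z.
by move=> /(_ isT); rewrite reD -/a -/c; lra.
Qed.
End BaseFrame.

(** * Moving the values of $\psi$ away from infinity *)

Section FinitePart.
Context {R : realType}.
Local Notation C := R[i].

(* The stabiliser of diag(1, -mu) moves infinity through infinitely many
   points, so it can be used to make finitely many values of psi finite. *)
Lemma avoid_infinity (I : eqType) (mu : R) (u : I -> 'cV[C]_2) (s : seq I) :
  mu != 0 -> (forall i, i \in s -> u i != 0) ->
  exists2 U : 'M[C]_2, \det U = 1 &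
    U *m mx2 1 0 0 (- mu%:C) *m dagger U = mx2 1 0 0 (- mu%:C) /\
    forall i, i \in s -> (invmx U *m u i) 1 0 != 0.
Proof.
move=> mu0 s0.
(* Infinitely many distinct parameters in $(0,\sqrt{|\mu|})$; the bound keeps $1-t^2/\mu$ positive,
   so that [al] below can be defined. *)
pose tau n : R := Num.sqrt `|mu| / n.+2%:R.
have sq0 : 0 < Num.sqrt `|mu| by rewrite sqrtr_gt0 normr_gt0.
have tau_inj : injective tau.
  move=> a b /(mulfI (lt0r_neq0 sq0))/invr_inj/eqP.
  by rewrite eqr_nat => /eqP[].
pose bad := [seq u i 1 0 / u i 0 0 | i <- s].
have [n hn] : exists n, (tau n)%:C \notin bad.
  have [/allP h|/allPn[_ /mapP[n _ ->] h]] :=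
    boolP (all (mem bad) [seq (tau n)%:C | n <- iota 0 (size bad).+1]); last by exists n.
  have uq : uniq [seq (tau n)%:C | n <- iota 0 (size bad).+1].
    by rewrite map_inj_uniq ?iota_uniq // => a b /complexI/tau_inj.
  by have := uniq_leq_size uq h; rewrite size_map size_iota ltnn.
pose t := tau n; have t2 : t ^+ 2 < `|mu|.
  rewrite /t /tau expr_div_n sqr_sqrtr // ltr_pdivrMr ?exprn_gt0 ?ltr0n //.
  by rewrite ltr_pMr ?normr_gt0 // -natrX ltr1n.
have d0 : 0 < 1 - t ^+ 2 / mu.
  have : t ^+ 2 / mu <= t ^+ 2 / `|mu|.
    apply: (le_trans (ler_norm _)); rewrite normrM normrV ?unitfE // ger0_norm ?sqr_ge0 //.
  have : t ^+ 2 / `|mu| < 1 by rewrite ltr_pdivrMr ?normr_gt0 // mul1r.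
  by lra.
pose al := (Num.sqrt (1 - t ^+ 2 / mu))^-1.
have al2 : al ^+ 2 * (1 - t ^+ 2 / mu) = 1.
  by rewrite /al exprVn sqr_sqrtr ?ltW // mulVf // gt_eqF.
have al0 : al != 0 by rewrite invr_eq0 sqrtr_eq0 -ltNge.
pose U : 'M[C]_2 := mx2 al%:C (t * al / mu)%:C (t * al)%:C al%:C.
have dU : \det U = 1.
  rewrite det2E !mxE /= -!rmorphM -rmorphB -(rmorph1 (real_complex R)); congr (_%:C).
  by rewrite -al2; field.
exists U => //; split.
  have muC : mu%:C != 0 :> C by rewrite fmorph_eq0.
  have al2C : al%:C ^+ 2 * (1 - t%:C ^+ 2 / mu%:C) = 1 :> C.
    by transitivity ((al ^+ 2 * (1 - t ^+ 2 / mu))%:C); [field; nz | rewrite al2].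
  apply: mx2P; rewrite !(mul2E, mxE) /= !conjR.
  - by rewrite -[RHS]al2C; field; nz.
  - by field; nz.
  - by field; nz.
  - transitivity (- mu%:C * (al%:C ^+ 2 * (1 - t%:C ^+ 2 / mu%:C))); first by field; nz.
    by rewrite al2C mulr1.
move=> i si; have u0 := s0 i si.
have uU : U \in unitmx by rewrite unitmxE dU unitr1.
pose v := invmx U *m u i; have uE : u i = U *m v by rewrite mulKVmx.
(* The second coordinate of $U^{-1}u_i$ vanishes only if $u_i$ is parallel to the first column of
   [U], that is, has slope [t]; [t] was chosen outside the list of these slopes. *)
apply/eqP => v1; have : br (U *m sp 1 0) (u i) = 0.
  by rewrite {1}uE brM dU mul1r /br !sp0 !sp1 v1; ring.
rewrite /br !mul2E !sp0 !sp1 !mxE /= !mulr1 !mulr0 !addr0 rmorphM /= => h.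
have {}h : u i 1 0 = t%:C * u i 0 0.
  have aC : al%:C != 0 :> C by rewrite fmorph_eq0.
  by apply: (mulfI aC); apply/eqP; rewrite -subr_eq0 -h; apply/eqP; ring.
have u00 : u i 0 0 != 0.
  by apply: contraNneq u0 => e; apply/eqP/cv2P; rewrite ?h e mxE ?mulr0.
move/negP: hn; apply; apply/mapP; exists i => //.
by rewrite h mulfK.
Qed.
End FinitePart.

(** * Reconstruction of the holomorphic data from the surface *)

Section Reconstruction.
Context {R : realType}.
Local Notation C := R[i].

Lemma gauss_mx_spinor (P : 'M[C]_2) z : P *m sp z 1 != 0 ->
  exists v c, [/\ c != 0, herm v = gauss_mx P z & nv (P *m sp z 1) = c *: v].
Proof.
rewrite /gauss_mx; have w0 : (P *m sp z 1) 0 0 = P 0 0 * z + P 0 1 by rewrite mul2E !mxE mulr1.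
have w1 : (P *m sp z 1) 1 0 = P 1 0 * z + P 1 1 by rewrite mul2E !mxE mulr1.
rewrite -w0 -w1 {w0 w1}; move: (P *m _) => a an.
have nvE c v : c != 0 -> herm v = c%:C^-1 *: outer a a -> nv a = c *: v.
  move=> c0 hv; apply: herm_inj; rewrite hermZ hv herm_nv scalerA mulfV ?scale1r //.
  by rewrite fmorph_eq0.
have hV c : herm (c^-1 *: nv a) = c%:C^-1 *: outer a a by rewrite hermZ herm_nv fmorphV.
have [q0|q0] := eqVneq (a 1 0) 0.
  have p0 : nsq (a 0 0) != 0.
    rewrite nsq_eq0; apply: contraNneq an => p0.
    by apply/eqP/cv2P; rewrite [RHS]mxE.
  exists ((nsq (a 0 0))^-1 *: nv a), (nsq (a 0 0)); split=> //; last exact: nvE.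
  have pC : (nsq (a 0 0))%:C != 0 :> C by rewrite fmorph_eq0.
  rewrite hV; apply: (scalerI pC); rewrite scalerA mulfV // scale1r.
  by apply: mx2P; rewrite !mxE /= ?q0 ?conjC0 ?mulr0 ?mul0r // mulr1 nsqE.
have n0 : nsq (a 1 0) != 0 by rewrite nsq_eq0.
exists ((nsq (a 1 0))^-1 *: nv a), (nsq (a 1 0)); split=> //; last exact: nvE.
have pC : (nsq (a 1 0))%:C != 0 :> C by rewrite fmorph_eq0.
rewrite hV; apply: (scalerI pC); rewrite scalerA mulfV // scale1r.
apply: mx2P; rewrite !mxE /= ?normCK nsqE; field; repeat (apply/andP; split); by rewrite ?fmorph_eq0.
Qed.

Section EdgeMatrix.
Context (psi : vertex -> C) (me : vertex -> vertex -> R) (m : R)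
  (s t : vertex -> vertex -> C) (i j : vertex).
Context (s0 : s i j != 0) (t0 : t i j != 0) (d0 : psi i - psi j != 0).

Lemma Bmx_fst : t i j ^+ 2 = (me i j + m)%:C ->
  Bmx psi me m s t i j *m sp (psi i) 1 = (t i j / s i j) *: sp (psi i) 1.
Proof.
move=> h; have -> : t i j / s i j = (me i j + m)%:C / (s i j * t i j).
  by rewrite -h; field; nz.
by apply: cv2P; rewrite !(mul2E, mxE) /=; field; nz.
Qed.

Lemma Bmx_snd : s i j ^+ 2 = (me i j)%:C ->
  Bmx psi me m s t i j *m sp (psi j) 1 = (s i j / t i j) *: sp (psi j) 1.
Proof.
move=> h; have -> : s i j / t i j = (me i j)%:C / (s i j * t i j).
  by rewrite -h; field; nz.
by apply: cv2P; rewrite !(mul2E, mxE) /=; field; nz.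
Qed.
End EdgeMatrix.

Lemma admissible_neq (x : surface R) G : admissible x G ->
  forall i j, edge predT i j -> x i != x j.
Proof.
move=> [h1 h2] i j e; have [k [l f]] := edge_face e.
apply: contraTneq (h2 _ _ _ _ f) => E.
by rewrite /edge_factor -E divff ?h1 // subrr mul0r ltxx.
Qed.

(** For $\mu=0$ the stabiliser of diag$(1,0)$ fixes infinity and cannot help, so finiteness is
    assumed; it will follow from $x_i\not\perp G_i$. *)
Lemma finite_frame (mu : R) (u : vertex -> 'cV[C]_2) p q :
  (forall i, rectangle p q i -> u i != 0) ->
  (mu = 0 -> forall i, rectangle p q i -> u i 1 0 != 0) ->
  exists2 U : 'M[C]_2, \det U = 1 &
    U *m mx2 1 0 0 (- mu%:C) *m dagger U = mx2 1 0 0 (- mu%:C) /\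
    forall i, rectangle p q i -> (invmx U *m u i) 1 0 != 0.
Proof.
move=> u0 umu; have [mu0|mu0] := eqVneq mu 0.
  exists 1%:M; rewrite ?det1 //; split.
    have -> : dagger 1%:M = 1%:M :> 'M[C]_2.
      by apply/matrixP => a b; rewrite daggerE !mxE eq_sym rmorph_nat.
    by rewrite mul1mx mulmx1.
  by move=> i hi; rewrite invmx1 mul1mx umu.
pose V : seq (int * int) := [seq (grid p a b : int * int) | a <- iota 0 `|q.1 - p.1|%N.+1, b <- iota 0 `|q.2 - p.2|%N.+1].
have [|U dU [hU hL]] := @avoid_infinity R (int * int)%type mu u [seq i <- V | rectangle p q i] mu0.
  by move=> i; rewrite mem_filter => /andP[hi _]; apply: u0.
exists U => //; split=> // i hi; apply: hL; rewrite mem_filter hi /=.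
rewrite (rectangle_grid hi); apply: allpairs_f; rewrite mem_iota /=;
  by move: hi; rewrite /rectangle; lia.
Qed.

Lemma weierstrass_reconstruction (mu : R) (x : surface R) (G : gauss_map R) :
  area_nondegenerate x ->
  (mu != 0 -> constant_mean_curvature mu x G (Num.sqrt `|mu|)^-1) ->
  (mu = 0 -> intrinsically_flat x G) ->
  admissible x G -> forall p q : vertex,
  exists psi me m Psi eps,
    [/\ weierstrass_frame (rectangle p q) psi me m Psi,
        frame_sign (rectangle p q) me m eps,
        weierstrass_representation (rectangle p q) mu psi Psi eps x G &
        positively_oriented mu x G -> forall i, rectangle p q i -> eps i = 1].
Proof.
move=> nondeg cmc flat adm p q.
have [setting [g [hg par A0]]] := gauss_section cmc flat (admissible_neq adm).
have [cw hcw] : {cw : vertex -> R * 'cV[C]_2 &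
    forall i, g i = (cw i).1 *: nv (cw i).2}.
  apply: (@boolp.choice _ _ (fun i (c : R * 'cV[C]_2) => g i = c.1 *: nv c.2)) => i; have [g0 _] := hg i.
  by have [c [w [_ _ e]]] := null_nv (mdot_gg setting hg i) g0; exists (c, w).
pose w i := (cw i).2; pose ga i := (cw i).1; have gw i : g i = ga i *: nv (w i) := hcw i.
pose lam i j := edge_factor x G i j; pose t1 i j := tau x G i j.
(* The edge factor has to be $1+m/m_{ij}$; with the normalisation $m=1$ this determines $m_{ij}$. *)
pose me i j := (lam i j - 1)^-1.
pose s i j := sqrtc (me i j)%:C; pose t i j := sqrtc (me i j + 1)%:C.
pose z i j := s i j / t i j.
have lam0 i j : edge predT i j -> lam i j != 0 by move=> e; exact: (edge_factor_neq0 setting adm hg e).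
have lam1 i j : edge predT i j -> lam i j - 1 != 0.
  by move=> e; rewrite subr_eq0; have := edge_factor_neq1 adm e.
have me0 i j : edge predT i j -> me i j != 0 by move=> e; rewrite invr_eq0 lam1.
have mem i j : edge predT i j -> me i j + 1 = lam i j / (lam i j - 1).
  by move=> e; rewrite /me; field; apply: lam1.
have mem0 i j : edge predT i j -> me i j + 1 != 0.
  by move=> e; rewrite mem // mulf_neq0 ?invr_eq0 ?lam0 ?lam1.
have s2 i j : s i j ^+ 2 = (me i j)%:C by exact: sqr_sqrtc.
have t2 i j : t i j ^+ 2 = (me i j + 1)%:C by exact: sqr_sqrtc.
have s0 i j : edge predT i j -> s i j != 0 by move=> e; rewrite sqrtc_eq0 fmorph_eq0 me0.
have t0 i j : edge predT i j -> t i j != 0 by move=> e; rewrite sqrtc_eq0 fmorph_eq0 mem0.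
have z0 i j : edge predT i j -> z i j != 0.
  by move=> e; apply: mulf_neq0; [exact: s0 | rewrite invr_eq0; exact: t0].
have tE i j : 1 - t1 i j = (lam i j)^-1 by rewrite /t1 /tau opprB addrC subrK.
have z2 i j : edge predT i j -> z i j ^+ 2 = (1 - t1 i j)%:C.
  move=> e; rewrite expr_div_n s2 t2 -fmorph_div; congr (_%:C).
  have := lam0 _ _ e; have := lam1 _ _ e => l1 l0.
  by rewrite mem // tE /me; field; nz.
have z2' i j : edge predT i j -> z i j ^+ 2 = 1 - (t1 i j)%:C.
  by move=> e; rewrite z2 // rmorphB rmorph1.
have lamS i j : edge predT i j -> lam i j = lam j i by move=> e; exact: (edge_factor_sym setting adm hg par e).
have lamF i j k l : face predT i j k l -> lam i j = lam l k /\ lam i l = lam j k.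
  by move=> f; exact: (face_factor setting nondeg adm hg par A0 f).
have br0 i j : edge predT i j -> br (w i) (w j) != 0 by move=> e; exact: (br_edge_neq0 setting adm hg par gw e).
have cross i j k l : face predT i j k l -> br (w i) (w j) * br (w k) (w l) =
    (t1 i j / t1 i l)%:C * (br (w j) (w k) * br (w l) (w i)).
  by move=> f; exact: (face_cross_spinor setting nondeg adm hg par A0 gw f).
have fl i j k l : lam i j = lam k l ->
    [/\ me i j = me k l, s i j = s k l, t i j = t k l, t1 i j = t1 k l & z i j = z k l].
  by move=> e; rewrite /z /s /t /me /t1 /tau -/(lam i j) -/(lam k l) e.
have HT i j : edge predT i j -> herm (x j) = (Num.sg (lam i j))%:C *:
    (transport (w i) (w j) (z i j) (t1 i j)%:C *m herm (x i)
      *m dagger (transport (w i) (w j) (z i j) (t1 i j)%:C)).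
  by move=> e; exact: (herm_transport setting adm hg par gw e (z2 _ _ e)).
have neg i j k l : face predT i j k l -> me i l / me i j < 0.
  move=> f; have [[eij _ _ _ _] eil] := face_edges f.
  have h := (proj2 adm) _ _ _ _ f; rewrite -/(lam i j) -/(lam i l) in h.
  have -> : me i l / me i j = ((lam i j - 1) * (lam i l - 1)) / (lam i l - 1) ^+ 2.
    by rewrite /me; field; rewrite ?lam1.
  by rewrite pmulr_llt0 // invr_gt0 exprn_even_gt0 //= lam1.
have po : positively_oriented mu x G -> forall i j, edge predT i j -> 0 < lam i j.
  by case=> _ h i j e; apply: h.
have t10 i j : edge predT i j -> t1 i j != 0 by move=> e; exact: (tau_neq0 adm e).
have meE i j : me i j = (lam i j - 1)^-1 by [].
have zE i j : z i j = s i j / t i j by [].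
clearbody z s t me t1 lam w.
pose T i j := transport (w i) (w j) (z i j) (t1 i j)%:C.
pose D : 'M[C]_2 := mx2 1 0 0 (- mu%:C).
pose step i j (Q : 'M[C]_2 * R) := (T i j *m Q.1, Q.2 * Num.sg (lam i j)).
(* The sign is transported together with the frame. Its last clause propagates because all edge
   factors of a positively oriented surface are positive. *)
pose I i (Q : 'M[C]_2 * R) := [/\ \det Q.1 = 1, Q.2 = 1 \/ Q.2 = -1,
  herm (x i) = (Q.2)%:C *: (Q.1 *m D *m dagger Q.1) & positively_oriented mu x G -> Q.2 = 1].
have sgl i j : edge predT i j -> Num.sg (lam i j) = 1 \/ Num.sg (lam i j) = -1.
  by move=> e; case: (sgrP (lam i j)) (lam0 _ _ e) => // _ _; [left|right].
have [_ hL no hxx] := setting.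
have dX i : \det (herm (x i)) = - mu%:C by rewrite det_herm hxx rmorphN.
have X0 i : herm (x i) != 0.
  apply/eqP => h; apply: (no i) => v _.
  have -> : x i = 0 by apply: herm_inj; rewrite h herm0.
  by rewrite mdotC mdot0r.
have [e0 [P0 dP0 [he0 hX0 hpos]]] := hermitian_frame (dagger_herm (x p)) (dX p) (X0 p).
have sgC i j : edge predT i j -> Num.sg (lam i j) ^+ 2 = 1.
  by move=> e; rewrite sqr_sg lam0.
have [|||| F [FI FE]] := @flat_section ('M[C]_2 * R)%type step I p q (P0, e0).
- move=> i j [P e] eij [/= d1 he hX hp]; have dT := transport_det (br0 _ _ eij) (z0 _ _ eij) (z2' _ _ eij).
  split=> /=.
  + by rewrite det_mulmx dT d1 mul1r.
  + by case: he => ->; case: (sgl _ _ eij) => ->; rewrite ?mul1r ?mulN1r ?opprK; auto.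
  + rewrite (HT _ _ eij) hX daggerM -scalemxAr -scalemxAl scalerA -rmorphM mulrC.
    by congr (_ *: _); rewrite !mulmxA.
  + by move=> hpo; rewrite (hp hpo) mul1r gtr0_sg // po.
- move=> i j [P e] eij; rewrite /step /=; have eji : edge predT j i by rewrite edge_sym.
  have [_ _ _ tji zji] := fl _ _ _ _ (lamS _ _ eij).
  congr (_, _); last by rewrite -(lamS _ _ eij) -mulrA -expr2 sgC // mulr1.
  rewrite mulmxA /T -zji -tji.
  by rewrite (transportK (br0 _ _ eij) (z0 _ _ eij) (z2' _ _ eij)) mul1mx.
- move=> i j k l [P e] f; rewrite /step /=.
  have [[eij ejk ekl eli elk] eil] := face_edges f.
  have [f1 f2] := lamF _ _ _ _ f.
  have [_ _ _ tE1 zE1] := fl _ _ _ _ f1; have [_ _ _ tE2 zE2] := fl _ _ _ _ f2.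
  apply: (congr2 pair); last by rewrite -f1 -f2 mulrAC.
  rewrite [LHS](mulmxA (T j k) (T i j) P) [RHS](mulmxA (T l k) (T i l) P).
  apply: (congr1 (fun M => M *m P)); rewrite /T -zE1 -zE2 -tE1 -tE2.
  have t0' : (t1 i l)%:C != 0 :> C by rewrite fmorph_eq0 t10.
  have Kt : (t1 i j / t1 i l)%:C * (t1 i l)%:C = (t1 i j)%:C :> C by rewrite fmorph_div divfK.
  exact: (transport_face (cross _ _ _ _ f) Kt (z0 _ _ eij) (z0 _ _ eil) (z2' _ _ eij)
    (br0 _ _ eij) (br0 _ _ ejk) (br0 _ _ ekl) (br0 _ _ eli)).
- split=> //= hpo; apply: hpos => mu0; have hp := proj1 hpo mu0 p.
  have [-> _ _ ->] := hermEx (x p); rewrite -rmorphD -rmorphB -rmorphD /=; lra.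
have TF i j : T i j *m w i = (z i j)^-1 *: w i by exact: transport_fst.
have TS i j : edge predT i j -> T i j *m w j = z i j *: w j.
  by move=> e; exact: (transport_snd (br0 _ _ e) (z0 _ _ e) (z2' _ _ e)).
have TD i j : edge predT i j -> \det (T i j) = 1.
  by move=> e; exact: (transport_det (br0 _ _ e) (z0 _ _ e) (z2' _ _ e)).
rewrite /step in FE; clearbody T; clear step HT.
pose Psi1 i := (F i).1; pose eps i := (F i).2.
have {}FI i : rectangle p q i -> [/\ \det (Psi1 i) = 1, eps i = 1 \/ eps i = -1,
  herm (x i) = (eps i)%:C *: (Psi1 i *m D *m dagger (Psi1 i)) & positively_oriented mu x G -> eps i = 1].
  exact: FI.
have PE i j : edge (rectangle p q) i j -> Psi1 j = T i j *m Psi1 i.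
  by move=> e; rewrite /Psi1 (FE _ _ e).
have eE i j : edge (rectangle p q) i j -> eps j = eps i * Num.sg (lam i j).
  by move=> e; rewrite /eps (FE _ _ e).
clearbody Psi1 eps; clear F FE.
have U1 i : rectangle p q i -> Psi1 i \in unitmx.
  by case/FI => d1 _ _ _; rewrite unitmxE d1 unitr1.
pose u i := invmx (Psi1 i) *m w i.
have wu i : rectangle p q i -> w i = Psi1 i *m u i by move=> hi; rewrite mulKVmx ?U1.
have g0 i : g i != 0 by case: (hg i).
have u0 i : rectangle p q i -> u i != 0.
  move=> hi; apply: contraNneq (g0 i) => h.
  by rewrite gw (wu i hi) h mulmx0 (_ : nv 0 = 0) ?scaler0 //; apply/eqP; rewrite nv_eq0.
have umu : mu = 0 -> forall i, rectangle p q i -> u i 1 0 != 0.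
  move=> mu0 i hi; have [d1 _ hX _] := FI i hi.
  (* For $\mu=0$ the form of diag$(1,0)$ at [u i] is $|u_1|^2$, which is proportional to
     $(x_i,g_i)$. *)
  apply: contraNneq (mdot_xg_neq0 setting hg i) => h.
  rewrite gw mdotZr; apply/eqP; rewrite -[RHS](mulr0 (ga i)); congr (_ * _).
  apply: complexI; rewrite mdot_nv (wu i hi) hX hqZ hqM d1 /hq h.
  have -> : D 1 1 = 0 by rewrite /D mu0 mxE /= rmorph0 oppr0.
  by rewrite conjC0 !(mul0r, mulr0, oppr0, subr0, addr0).
have [U dU [hU hv]] := finite_frame u0 umu.
have UU : U \in unitmx by rewrite unitmxE dU unitr1.
pose Psi i := Psi1 i *m U; pose v i := invmx U *m u i.
pose psi i := v i 0 0 / v i 1 0.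
have PsiE i j : edge (rectangle p q) i j -> Psi j = T i j *m Psi i.
  by move=> e; rewrite /Psi (PE _ _ e) mulmxA.
have dPsi i : rectangle p q i -> \det (Psi i) = 1.
  by move=> hi; have [d1 _ _ _] := FI i hi; rewrite det_mulmx d1 dU mulr1.
have hX i : rectangle p q i -> herm (x i) = (eps i)%:C *: (Psi i *m D *m dagger (Psi i)).
  move=> hi; have [_ _ -> _] := FI i hi; congr (_ *: _).
  by rewrite /Psi daggerM -!mulmxA; congr (_ *m _); rewrite !mulmxA hU.
have wE i : rectangle p q i -> w i = v i 1 0 *: (Psi i *m sp (psi i) 1).
  move=> hi; rewrite scalemxAr (_ : v i 1 0 *: sp (psi i) 1 = v i).
    by rewrite /Psi /v -mulmxA mulKVmx // wu.
  apply: cv2P; rewrite [LHS]mxE ?sp0 ?sp1; last by rewrite mulr1.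
    by rewrite /psi mulrC divfK // hv.
have PsiS i j : edge (rectangle p q) i j ->
    w j = (v j 1 0 * z i j) *: (Psi i *m sp (psi j) 1).
  move=> e; have [e' [hi hj]] := edge_pred e.
  have uT : T i j \in unitmx by rewrite unitmxE TD // unitr1.
  rewrite -[LHS](mulKmx uT) TS // {1}(wE j hj) (PsiE _ _ e) -mulmxA.
  by rewrite -!scalemxAr (mulKmx uT) scalerA mulrC.
have {}hv i : rectangle p q i -> v i 1 0 != 0 by exact: hv.
clearbody psi v Psi.
have brE i j : edge (rectangle p q) i j ->
    br (w i) (w j) = v i 1 0 * v j 1 0 * z i j * (psi i - psi j).
  move=> e; have [e' [hi hj]] := edge_pred e.
  rewrite (PsiS _ _ e) {1}(wE i hi) brZl brZr brM dPsi // mul1r /br !sp0 !sp1; ring.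
have d0 i j : edge (rectangle p q) i j -> psi i - psi j != 0.
  move=> e; have [e' _] := edge_pred e; apply: contraNneq (br0 _ _ e') => h.
  by rewrite brE // h mulr0.
exists psi, me, 1, Psi, eps; split.
- split.
  + split=> [i j e|i j k l f].
      have [e' _] := edge_pred e; have [h _ _ _ _] := fl _ _ _ _ (lamS _ _ e').
      by split; [exact: h | exact: me0].
    have f' := face_pred f; have [f1 f2] := lamF _ _ _ _ f'.
    have [m1 _ _ _ z1] := fl _ _ _ _ f1; have [m2 _ _ _ z2j] := fl _ _ _ _ f2.
    have [[eij ejk ekl eli elk] eil] := face_edges f.
    have [[eij' ejk' ekl' eli' elk'] eil'] := face_edges f'.
    split; [exact: m1 | exact: m2 | | exact: neg f'].
    have [_ [hi hj]] := edge_pred eij; have [_ [hk hl]] := edge_pred ekl.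
    have [_ _ _ _ zkl] := fl _ _ _ _ (lamS _ _ ekl').
    have [_ _ _ _ zli] := fl _ _ _ _ (lamS _ _ eli').
    have := cross _ _ _ _ f'; rewrite (brE _ _ eij) (brE _ _ ekl) (brE _ _ ejk) (brE _ _ eli).
    rewrite zkl zli -z1 -z2j.
    have := z2 _ _ eij'; have := z2 _ _ eil'; rewrite !tE.
    have vi := hv _ hi; have vj := hv _ hj; have vk := hv _ hk; have vl := hv _ hl.
    have djk := d0 _ _ ejk; have dli := d0 _ _ eli.
    have l1 := lam0 _ _ eij'; have l2 := lam0 _ _ eil'.
    have k1 := lam1 _ _ eij'; have k2 := lam1 _ _ eil'.
    have t1E : t1 i j = 1 - (lam i j)^-1 by rewrite -tE; ring.
    have t2E : t1 i l = 1 - (lam i l)^-1 by rewrite -tE; ring.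
    rewrite !meE t1E t2E.
    move: (z i l) (z i j) => Z2 Z1 hZ2 hZ1 H.
    have Z10 : Z1 ^+ 2 != 0 by rewrite hZ1 fmorph_eq0 invr_eq0.
    (* The cross ratio of $\psi$ is that of [w] times $z_{il}^2/z_{ij}^2$. Since $z^2=1/\lambda$ and
       $(1-1/\lambda)\lambda=\lambda-1$, the ratio of the $\tau$ becomes the ratio of labels. *)
    have hK : ((1 - (lam i j)^-1) / (1 - (lam i l)^-1))%:C * Z2 ^+ 2 =
        ((lam i l - 1)^-1 / (lam i j - 1)^-1)%:C * Z1 ^+ 2.
      rewrite hZ1 hZ2 -!rmorphM; congr (_%:C); field.
      by rewrite k1 k2 l1 l2.
    have V0 : v i 1 0 * v j 1 0 * v k 1 0 * v l 1 0 * Z1 ^+ 2 != 0.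
      exact: (mulf_neq0 (mulf_neq0 (mulf_neq0 (mulf_neq0 vi vj) vk) vl) Z10).
    apply: (mulfI (mulf_neq0 V0 (mulf_neq0 djk dli))).
    transitivity (v i 1 0 * v j 1 0 * Z1 * (psi i - psi j) *
        (v k 1 0 * v l 1 0 * Z1 * (psi k - psi l))); first by field; nz.
    rewrite H; move: hK.
    set K1 := (_ / (1 - (lam i l)^-1))%:C; set K2 := (_ / (lam i j - 1)^-1)%:C => hK.
    clearbody K1 K2.
    transitivity (v i 1 0 * v j 1 0 * v k 1 0 * v l 1 0 * (psi j - psi k) * (psi l - psi i)
      * (K1 * Z2 ^+ 2)); first by ring.
    by rewrite hK; ring.
  + exact: oner_neq0.
  + by move=> i j e; have [e' _] := edge_pred e; exact: mem0.
  + exact: dPsi.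
  exists s, t; split.
  + split=> [i j e|i j k l f].
      have [e' _] := edge_pred e; have [_ h _ _ _] := fl _ _ _ _ (lamS _ _ e').
      by split; [exact: s2 | exact: h].
    have f' := face_pred f; have [f1 f2] := lamF _ _ _ _ f'.
    by have [_ h1 _ _ _] := fl _ _ _ _ f1; have [_ h2 _ _ _] := fl _ _ _ _ f2.
  + split=> [i j e|i j k l f].
      have [e' _] := edge_pred e; have [_ _ h _ _] := fl _ _ _ _ (lamS _ _ e').
      by split; [exact: t2 | exact: h].
    have f' := face_pred f; have [f1 f2] := lamF _ _ _ _ f'.
    by have [_ _ h1 _ _] := fl _ _ _ _ f1; have [_ _ h2 _ _] := fl _ _ _ _ f2.
  move=> i j e; have [e' [hi hj]] := edge_pred e.
  have bsp : br (sp (psi i) 1) (sp (psi j) 1) != 0 :> C.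
    by rewrite /br !sp0 !sp1 mulr1 mul1r d0.
  have vi := hv _ hi; have vj := hv _ hj; have zn := z0 _ _ e'.
  have Ei : Psi i *m sp (psi i) 1 = (v i 1 0)^-1 *: w i.
    by rewrite (wE i hi) scalerA mulVf // scale1r.
  have Ej : Psi i *m sp (psi j) 1 = (v j 1 0 * z i j)^-1 *: w j.
    by rewrite (PsiS _ _ e) scalerA mulVf ?scale1r // mulf_neq0.
  have Bi := Bmx_fst (s0 _ _ e') (t0 _ _ e') (d0 _ _ e) (t2 _ _).
  have Bj := Bmx_snd 1 (s0 _ _ e') (t0 _ _ e') (d0 _ _ e) (s2 _ _).
  have zV : t i j / s i j = (z i j)^-1 by rewrite zE invf_div.
  (* $T_{ij}\Psi_i$ and $\Psi_iB_{ij}$ agree on the eigenvectors $(\psi_i,1)$ and $(\psi_j,1)$ of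
     $B_{ij}$, which $\Psi_i$ maps to multiples of $w_i$ and $w_j$. *)
  rewrite (PsiE _ _ e); apply: (mx_eq_basis bsp); rewrite -!mulmxA.
    rewrite Bi zV -[RHS]scalemxAr Ei -[LHS]scalemxAr TF !scalerA.
    by congr (_ *: _); rewrite mulrC.
  rewrite Bj -zE -[RHS]scalemxAr Ej -[LHS]scalemxAr TS // !scalerA.
  by congr (_ *: _); rewrite mulrC.
- split=> [i hi|i j e]; first by have [_ h _ _] := FI i hi.
  have [e' _] := edge_pred e; rewrite (eE _ _ e); congr (_ * _).
  have m0 := me0 _ _ e'; have l1 := lam1 _ _ e'; rewrite mem // meE.
  have -> : (lam i j - 1)^-1 * (lam i j / (lam i j - 1)) = lam i j * ((lam i j - 1)^-1) ^+ 2.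
    by field.
  by rewrite sgrM [X in _ * X]gtr0_sg ?mulr1 // exprn_even_gt0 //= invr_eq0.
- move=> i hi; split; first exact: hX.
  have P0' : Psi i *m sp (psi i) 1 != 0.
    apply: contraNneq (g0 i) => h.
    by rewrite gw (wE i hi) h scaler0 (_ : nv 0 = 0) ?scaler0 //; apply/eqP; rewrite nv_eq0.
  have [y [c [c0 hy hc]]] := gauss_mx_spinor P0'; exists y => //.
  have [_ <-] := hg i.
  have [a a0 ->] : exists2 a, a != 0 & g i = a *: y.
    exists (ga i * nsq (v i 1 0) * c); last by rewrite gw (wE i hi) nvZ hc !scalerA.
    rewrite !mulf_neq0 // ?nsq_eq0 ?hv //.
    by apply: contraNneq (g0 i) => h; rewrite gw h scale0r.
  apply/eqP; rewrite eqEsubv -!memvE memvZ ?memv_line //=.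
  by apply/vlineP; exists a^-1; rewrite scalerA mulVf // scale1r.
by move=> hpo i hi; have [_ _ _ h] := FI i hi; exact: h.
Qed.
End Reconstruction.

Theorem theorem4p7 (R : realType) (mu : R) :
  [/\ forall (psi : vertex -> R[i]) (me : vertex -> vertex -> R) (m : R)
             (Psi : vertex -> 'M[R[i]]_2) (eps : vertex -> R)
             (x : surface R) (G : gauss_map R),
        weierstrass_frame predT psi me m Psi ->
        frame_sign predT me m eps ->
        weierstrass_representation predT mu psi Psi eps x G ->
        nowhere_orthogonal x G ->
        (mu != 0 ->
           constant_mean_curvature mu x G (Num.sqrt `|mu|)^-1) /\
        (mu = 0 -> intrinsically_flat x G),
      forall (x : surface R) (G : gauss_map R),
        area_nondegenerate x ->
        (mu != 0 ->
           constant_mean_curvature mu x G (Num.sqrt `|mu|)^-1) ->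
        (mu = 0 -> intrinsically_flat x G) ->
        admissible x G ->
        forall p q : vertex,
        exists (psi : vertex -> R[i]) (me : vertex -> vertex -> R) (m : R)
               (Psi : vertex -> 'M[R[i]]_2) (eps : vertex -> R),
          [/\ weierstrass_frame (rectangle p q) psi me m Psi,
              frame_sign (rectangle p q) me m eps,
              weierstrass_representation (rectangle p q) mu psi Psi eps x G &
              positively_oriented mu x G ->
                forall i, rectangle p q i -> eps i = 1] &
      forall (psi : vertex -> R[i]) (me : vertex -> vertex -> R) (m : R)
             (Psi : vertex -> 'M[R[i]]_2) (eps : vertex -> R)
             (x : surface R) (G : gauss_map R),
        weierstrass_frame predT psi me m Psi ->
        frame_sign predT me m eps ->
        weierstrass_representation predT mu psi Psi eps x G ->
        nowhere_orthogonal x G ->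
        omega_dual x G].
Proof.
split.
- move=> psi me m Psi eps x G frame signs repr nonorth; split=> [mu0|mu0].
    exact: (rep_cmc frame signs repr nonorth mu0).
  exact: (rep_flat frame signs repr nonorth mu0).
- exact: weierstrass_reconstruction.
move=> psi me m Psi eps x G frame signs repr nonorth.
exact: (rep_omega_dual frame signs repr nonorth).
Qed.
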